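(* Let $E|k$ be a finite extension of non-Archimedean local fields with ramification index $e$ and residue degree $f$, and let $E_{ur}$ be its maximal unramified subextension. (a) If $E|k$ is normal, or $E$ is $k$-isomorphic to $K\otimes_kU$ with $K|k$ totally ramified and $U|k$ unramified, then $E|k$ has the strong extension property. (b) If $\gcd(e,f)=1$, the following are equivalent: 1. $E|k$ has the strong extension property; 2. $f$ divides $\#\mathrm{Aut}(E|k)$; 3. $\mathrm{Aut}(E|k)\cong\mathrm{Aut}(E|E_{ur})\rtimes\mathbb Z/f\mathbb Z$; 4. $\mathrm{Aut}(E|k)$ has a subgroup of order $f$; 5. there is an intermediate field $k\subseteq E'\subseteq E$ with $[E':k]=e$; 6. $E$ is $k$-algebra isomorphic to $K\otimes_kU$ with $K|k$ totally ramified and $U|k$ unramified.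
   Context: $\mathrm{Aut}(E|k)$ denotes the group of $k$-algebra automorphisms of $E$. $E|k$ has the strong extension property if the Frobenius automorphism of $E_{ur}|k$ extends to an element of $\mathrm{Aut}(E|k)$. *)

(* Defs.v *)
From HB Require Import structures.
From mathcomp Require Import all_boot all_order all_algebra all_field.
Set Implicit Arguments. Unset Strict Implicit. Unset Printing Implicit Defensive.
Import Order.TTheory GRing.Theory Num.Theory.
Local Open Scope ring_scope.

(* A normalized discrete valuation v : F^x ->> Z (values at 0 are irrelevant). *)
Definition is_dval (F : fieldType) (v : F -> int) : Prop :=
  [/\ exists pi : F, pi != 0 /\ v pi = 1,
      forall x y : F, x != 0 -> y != 0 -> v (x * y) = v x + v y
    & forall x y : F, x != 0 -> y != 0 -> x + y != 0 ->
        Num.min (v x) (v y) <= v (x + y)].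

Definition vint (F : fieldType) (v : F -> int) (x : F) : Prop :=
  x = 0 \/ 0 <= v x.

Definition vcong (F : fieldType) (v : F -> int) (x y : F) : Prop :=
  x = y \/ 0 < v (x - y).

Definition vcomplete (F : fieldType) (v : F -> int) : Prop :=
  forall u : nat -> F,
    (forall N : int, exists M : nat, forall m n : nat, (M <= m)%N -> (M <= n)%N ->
        u m = u n \/ N <= v (u m - u n)) ->
    exists l : F, forall N : int, exists M : nat, forall n : nat, (M <= n)%N ->
        u n = l \/ N <= v (u n - l).

(* the residue field O/m has exactly q elements: s is a system of representatives *)
Definition res_card (F : fieldType) (v : F -> int) (q : nat) : Prop :=
  exists s : seq F,
    [/\ size s = q, uniq s,
        forall x, x \in s -> vint v x,
        forall x y, x \in s -> y \in s -> vcong v x y -> x = y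
      & forall x, vint v x -> exists2 y, y \in s & vcong v x y].

Definition local_field (F : fieldType) (v : F -> int) : Prop :=
  [/\ is_dval v, vcomplete v & exists q : nat, res_card v q].

Definition ext_val (k : fieldType) (L : fieldExtType k) (v : k -> int)
    (w : L -> int) (e : nat) : Prop :=
  is_dval w /\ forall a : k, a != 0 -> w (a%:A) = (e%:Z * v a).

Definition ram_index (k : fieldType) (v : k -> int) (L : fieldExtType k) (e : nat) : Prop :=
  exists w : L -> int, ext_val v w e.

Definition unramified (k : fieldType) (v : k -> int) (L : fieldExtType k) : Prop :=
  ram_index v L 1.

Definition totally_ramified (k : fieldType) (v : k -> int) (L : fieldExtType k) : Prop :=
  ram_index v L (\dim {:L}).

Definition max_unram (k : fieldType) (v : k -> int) (E : fieldExtType k)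
    (Eur : {subfield E}) : Prop :=
  unramified v (subvs_of Eur) /\
  forall M : {subfield E}, unramified v (subvs_of M) -> (M <= Eur)%VS.

Definition autk (k : fieldType) (E : fieldExtType k) (g : 'End(E)) : bool :=
  kAut 1%VS fullv g.

Definition autM (k : fieldType) (E : fieldExtType k) (M : {subfield E}) (g : 'End(E)) : bool :=
  kAut M fullv g.

Definition card_aut (k : fieldType) (E : fieldExtType k) (n : nat) : Prop :=
  exists s : seq 'End(E), [/\ uniq s, size s = n & forall g, (g \in s) = autk g].

(* strong extension property: some tau in Aut(E|k) restricts on E_ur to the
   Frobenius of E_ur|k, i.e. to the k-automorphism of E_ur inducing x |-> x^q
   on the residue field (q = #residue field of k) *)
Definition strong_ext (k : fieldType) (E : fieldExtType k) (w : E -> int) (q : nat)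
    (Eur : {subfield E}) : Prop :=
  exists tau : 'End(E),
    [/\ autk tau, kAut 1%VS Eur tau
      & forall x, x \in Eur -> vint w x -> vcong w (tau x) (x ^+ q)].

Definition aut_subgroup (k : fieldType) (E : fieldExtType k) (n : nat) : Prop :=
  exists s : seq 'End(E),
    [/\ uniq s, size s = n & forall g, g \in s -> autk g] /\
    [/\ \1%VF \in s,
        forall g h, g \in s -> h \in s -> (g \o h)%VF \in s
      & forall g, g \in s -> (g^-1)%VF \in s].

(* Aut(E|k) is isomorphic to Aut(E|Eur) ⋊_phi Z/fZ for some action phi
   (semidirect product law (n1,c1)(n2,c2) = (n1 phi_c1(n2), c1+c2 mod f);
   group law on automorphisms is composition). *)
Definition aut_semidirect (k : fieldType) (E : fieldExtType k) (Eur : {subfield E})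
    (f : nat) : Prop :=
  let N := autM Eur in
  exists (phi : nat -> 'End(E) -> 'End(E)) (Psi : 'End(E) -> nat -> 'End(E)),
  [/\ forall c n, (c < f)%N -> N n -> N (phi c n),
      forall c n m, (c < f)%N -> N n -> N m -> phi c (n \o m)%VF = (phi c n \o phi c m)%VF,
      forall c n m, (c < f)%N -> N n -> N m -> phi c n = phi c m -> n = m
    & forall c m, (c < f)%N -> N m -> exists2 n, N n & phi c n = m] /\
  [/\ forall n, N n -> phi 0%N n = n
    & forall c1 c2 n, (c1 < f)%N -> (c2 < f)%N -> N n ->
         phi ((c1 + c2) %% f)%N n = phi c1 (phi c2 n)] /\
  [/\ forall n c, N n -> (c < f)%N -> autk (Psi n c),
      forall n1 c1 n2 c2, N n1 -> (c1 < f)%N -> N n2 -> (c2 < f)%N ->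
         Psi n1 c1 = Psi n2 c2 -> n1 = n2 /\ c1 = c2,
      forall g, autk g -> exists n, exists2 c, N n /\ (c < f)%N & Psi n c = g
    & forall n1 c1 n2 c2, N n1 -> (c1 < f)%N -> N n2 -> (c2 < f)%N ->
         Psi (n1 \o phi c1 n2)%VF ((c1 + c2) %% f)%N = (Psi n1 c1 \o Psi n2 c2)%VF].

Definition normal_ext (k : fieldType) (E : fieldExtType k) : Prop :=
  forall x : E, exists r : seq E, minPoly 1%VS x = \prod_(y <- r) ('X - y%:P).

(* L is k-algebra isomorphic to K ⊗_k U: there are k-algebra morphisms
   iK : K -> L, iU : U -> L such that the induced k-linear map K ⊗_k U -> L,
   x ⊗ y |-> iK x * iU y, is bijective, i.e. sends the basis (x_i ⊗ y_j) of
   K ⊗_k U to a basis of L. *)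
Definition tensor_iso (k : fieldType) (K U L : fieldExtType k) : Prop :=
  exists (iK : 'Hom(K, L)) (iU : 'Hom(U, L)),
    [/\ iK 1 = 1, forall x y, iK (x * y) = iK x * iK y,
        iU 1 = 1, forall x y, iU (x * y) = iU x * iU y
      & basis_of fullv
          [seq iK x * iU y | x <- (vbasis {:K} : seq K), y <- (vbasis {:U} : seq U)]].

Definition tensor_decomp (k : fieldType) (v : k -> int) (E : fieldExtType k) : Prop :=
  exists (K U : fieldExtType k),
    [/\ totally_ramified v K, unramified v U & tensor_iso K U E].

(* Main.v *)
Require Import Defs.
From HB Require Import structures.
From mathcomp Require Import all_boot all_order all_algebra all_solvable all_field.
From mathcomp Require Import zify.
From Stdlib Require Import Classical ClassicalEpsilon.
(** Every extension of the valuation of k to a finite extension is unique up to scaling, because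
    its valuation ring is spanned over that of k by finitely many digits modulo a uniformizer pi
    of k. With Q = q ^ f the order of the residue field of E, Teichmueller representatives give
    a primitive (Q - 1)-th root of unity z in E. Its conjugates over k are exactly the
    z ^+ (q ^ i) with i < f, so k(z) is unramified of degree f and equals E_ur, [E : k(z)] = e,
    and the strong extension property says that some k-automorphism of E maps z to z ^+ q.

    Normality extends the Frobenius of k(z) to E. If E' has degree e over k and E' k(z) = E, then
    z has the same minimal polynomial over E' as over k, and z |-> z ^+ q extends to an
    E'-automorphism of E; this covers tensor decompositions and, for e and f coprime, all
    subfields of degree e. In the coprime case Artin's theorem shows that #Aut(E | E_ur) divides e,
    hence is prime to f, so that f | #Aut(E | k) yields a lift of Frobenius, which can moreover be
    chosen of order f; and the fixed field of a subgroup of order f has degree e over k. *)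

Set Implicit Arguments. Unset Strict Implicit. Unset Printing Implicit Defensive.
Import Order.TTheory GRing.Theory Num.Theory.
Local Open Scope ring_scope.

(** * Valuations *)

(** Only k is assumed complete, and [unramified] and [totally_ramified] ask for some valuation on
    the subextension, which then has to be compared with [w]. One device meets both difficulties:
    integral elements are integral k-combinations of finitely many digits, so limits are taken
    coordinatewise in k, and any other extension of [v] is bounded below on them. Restricting [w] to
    a subfield destroys normalization, whence valuations without surjectivity ([is_val],
    [ext_pval]). Teichmueller representatives take the place of Hensel's lemma: powers of z
    congruent modulo the maximal ideal are equal, so statements about the residue of z become
    identities in E. As E|k may be inseparable, groups of automorphisms are finite lists in
    ['End(E)], and Artin's theorem gives separability over each fixed field. The relation [E : k] =
    e f is derived, since [e] and [f] are given only through [w] and the residue fields. *)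

Definition is_val (F : fieldType) (w : F -> int) : Prop :=
  (forall x y, x != 0 -> y != 0 -> w (x * y) = w x + w y) /\
  (forall x y, x != 0 -> y != 0 -> x + y != 0 ->
     Num.min (w x) (w y) <= w (x + y)).

Lemma dval_val (F : fieldType) (w : F -> int) : is_dval w -> is_val w.
Proof. by case. Qed.

(* [w 0] is a junk value; [vge] treats 0 as having infinite valuation. *)
Definition vge (F : fieldType) (w : F -> int) (N : int) (x : F) : bool :=
  (x == 0) || (N <= w x).

Lemma vintP (F : fieldType) (w : F -> int) x : vint w x <-> vge w 0 x.
Proof.
split; first by case=> [->|h]; rewrite /vge ?eqxx // h orbT.
by case/orP => [/eqP|]; [left | right].
Qed.

Lemma vcongP (F : fieldType) (w : F -> int) x y : vcong w x y <-> vge w 1 (x - y).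
Proof.
rewrite /vcong /vge subr_eq0; split; first by case=> [->|h]; rewrite ?eqxx // orbC; lia.
by case/orP => [/eqP|h]; [left | right; lia].
Qed.

Section Valuation.
Variables (F : fieldType) (w : F -> int) (hw : is_val w).
Local Notation vg := (vge w).

Lemma vwM x y : x != 0 -> y != 0 -> w (x * y) = w x + w y.
Proof. by case: hw => + _; apply. Qed.

Lemma vw1 : w 1 = 0.
Proof.
have : w 1 = w 1 + w 1 by rewrite -vwM ?oner_eq0 ?mulr1.
lia.
Qed.

Lemma vwX x n : x != 0 -> w (x ^+ n) = n%:Z * w x.
Proof.
move=> x0; elim: n => [|n IH]; first by rewrite expr0 vw1; lia.
by rewrite exprS vwM ?expf_neq0 // IH; lia.
Qed.

Lemma vwV x : x != 0 -> w x^-1 = - w x.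
Proof.
move=> x0; have := vwM x0 (invr_neq0 x0).
by rewrite divff // vw1; lia.
Qed.

Lemma vwN x : w (- x) = w x.
Proof.
have [->|x0] := eqVneq x 0; first by rewrite oppr0.
have h1 : w (-1) = 0.
  have := @vwX (-1) 2; rewrite sqrrN expr1n vw1 oppr_eq0 oner_eq0 => /(_ isT); lia.
by rewrite -mulN1r vwM ?oppr_eq0 ?oner_eq0 // h1 add0r.
Qed.

Lemma vge0 N : vg N 0.
Proof. by rewrite /vge eqxx. Qed.

Lemma vgeE N x : x != 0 -> vg N x = (N <= w x).
Proof. by rewrite /vge => /negPf ->. Qed.

Lemma vgew N M x : M <= N -> vg N x -> vg M x.
Proof. by move=> h; rewrite /vge; case: (x == 0) => //=; lia. Qed.

Lemma vgeN N x : vg N (- x) = vg N x.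
Proof. by rewrite /vge oppr_eq0 vwN. Qed.

Lemma vgeD N x y : vg N x -> vg N y -> vg N (x + y).
Proof.
rewrite /vge; have [->|x0] /= := eqVneq x 0; first by rewrite add0r.
have [->|y0] /= := eqVneq y 0; first by rewrite addr0 (negPf x0).
have [//|s0] /= := eqVneq (x + y) 0 => h1 h2.
by case: hw => _ /(_ _ _ x0 y0 s0); apply: le_trans; rewrite le_min h1 h2.
Qed.

Lemma vgeB N x y : vg N x -> vg N y -> vg N (x - y).
Proof. by move=> hx hy; apply: vgeD => //; rewrite vgeN. Qed.

Lemma vgeM N M x y : vg N x -> vg M y -> vg (N + M) (x * y).
Proof.
rewrite /vge mulf_eq0; have [//|x0] /= := eqVneq x 0.
by have [//|y0] /= := eqVneq y 0 => h1 h2; rewrite vwM //; lia.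
Qed.

Lemma vgeMl N x y : vg 0 x -> vg N y -> vg N (x * y).
Proof. by move=> hx hy; rewrite -[N]add0r; apply: vgeM. Qed.

Lemma vgeMr N x y : vg N x -> vg 0 y -> vg N (x * y).
Proof. by move=> hx hy; rewrite mulrC; apply: vgeMl. Qed.

Lemma vge1 : vg 0 1.
Proof. by rewrite vgeE ?oner_eq0 // vw1. Qed.

Lemma vge_nat n : vg 0 n%:R.
Proof. by elim: n => [|n IH]; rewrite ?vge0 // -natr1 vgeD ?vge1. Qed.

Lemma vgeX x n : vg 0 x -> vg 0 (x ^+ n).
Proof. by move=> hx; elim: n => [|n IH]; rewrite ?expr0 ?vge1 // exprS vgeMl. Qed.

Lemma vge_sum (I : Type) (r : seq I) (P : pred I) (G : I -> F) N :
  (forall i, P i -> vg N (G i)) -> vg N (\sum_(i <- r | P i) G i).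
Proof. by move=> h; elim/big_ind: _ => //; [apply: vge0 | apply: vgeD]. Qed.

Lemma vge_all x : (forall n : nat, vg n%:Z x) -> x = 0.
Proof.
move=> h; apply/eqP; apply: contraT => x0.
by have := h (absz (w x)).+1; rewrite vgeE //; lia.
Qed.

Lemma vge_unit x : vg 0 x -> ~~ vg 1 x -> x != 0 /\ w x = 0.
Proof.
by rewrite /vge; case: (x == 0) => //=; lia.
Qed.

Lemma vge_unitV x : vg 0 x -> ~~ vg 1 x -> vg 0 x^-1.
Proof.
by move=> h1 h2; have [x0 wx] := vge_unit h1 h2; rewrite vgeE ?invr_eq0 // vwV // wx.
Qed.

Lemma vge_subX x y N n : vg 0 x -> vg 0 y -> vg N (x - y) -> vg N (x ^+ n - y ^+ n).
Proof.
move=> hx hy h; rewrite subrXX; apply: vgeMr => //; apply: vge_sum => i _.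
by apply: vgeMl; apply: vgeX.
Qed.

Lemma vge_subC N x y : vg N (x - y) = vg N (y - x).
Proof. by rewrite -vgeN opprB. Qed.

Lemma vge_sub_trans N y x z : vg N (x - y) -> vg N (y - z) -> vg N (x - z).
Proof. by move=> h1 h2; rewrite -(subrK y x) -addrA vgeD. Qed.

Lemma vge_addl N x y : vg N x -> vg N (x + y) = vg N y.
Proof.
move=> hx; apply/idP/idP => h; last exact: vgeD.
by rewrite -(addKr x y) vgeD ?vgeN.
Qed.

Lemma vge_subr N x y : vg N (x - y) -> vg N y = vg N x.
Proof. by move=> h; rewrite -(subrK y x) vge_addl. Qed.

(** The least valuation of a nonzero term is attained only once, so that term cannot be cancelled.
    This serves to refute polynomial relations whose terms have distinct valuations. *)
Lemma val_sum_distinct (n : nat) (a : nat -> F) :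
  (exists2 i, (i < n)%N & a i != 0) ->
  (forall i j, (i < n)%N -> (j < n)%N -> a i != 0 -> a j != 0 -> w (a i) = w (a j) -> i = j) ->
  \sum_(i < n) a i != 0 /\ exists2 i, (i < n)%N /\ a i != 0 & w (\sum_(i < n) a i) = w (a i).
Proof.
elim: n => [|n IH] [i0 hi0 ai0] hd; first by [].
have hd' : forall i j, (i < n)%N -> (j < n)%N -> a i != 0 -> a j != 0 -> w (a i) = w (a j) -> i = j.
  by move=> i j hi hj; apply: hd; lia.
rewrite big_ord_recr /=; set S := \sum_(i < n) _.
have [an0|an] := eqVneq (a n) 0.
  have hi : (i0 < n)%N.
    have : i0 <> n by move=> Ei; move: ai0; rewrite Ei an0 eqxx.
    by lia.
  rewrite an0 addr0; have [hs [i [hi1 hi2] hi3]] := IH (ex_intro2 _ _ i0 hi ai0) hd'.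
  by split=> //; exists i => //; split=> //; lia.
have [[i1 hi1 ai1]|hno] := classic (exists2 i, (i < n)%N & a i != 0); last first.
  have S0 : S = 0.
    rewrite /S big1 // => i _; apply/eqP; apply: contraT => ai.
    by case: hno; exists i.
  by rewrite S0 add0r; split=> //; exists n.
have [hS [i [hi2 ai] wS]] := IH (ex_intro2 _ _ i1 hi1 ai1) hd'.
rewrite -/S in hS wS.
have ne : w S != w (a n).
  apply/eqP; rewrite wS => E; have : i = n by apply: hd; lia || exact.
  lia.
have hSn : S + a n != 0.
  by rewrite addr_eq0; apply: contra ne => /eqP ->; rewrite vwN.
split=> //.
have [hlt|hge] := ltP (w S) (w (a n)).
  exists i; first by split=> //; lia.
  rewrite -wS; apply/le_anti/andP; split.
    rewrite leNgt; apply/negP => h.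
    have : vg (w S + 1) (S + a n - a n) by apply: vgeB; rewrite vgeE // lezD1.
    by rewrite addrK vgeE //; lia.
  by rewrite -[_ <= _](vgeE _ hSn) vgeD // vgeE //; lia.
exists n; first by split.
apply/le_anti/andP; split.
  rewrite leNgt; apply/negP => h.
  have : vg (w (a n) + 1) (S + a n - S) by apply: vgeB; rewrite vgeE // lezD1 // lt_neqAle eq_sym ne.
  by rewrite [S + a n]addrC addrK vgeE //; lia.
by rewrite -[_ <= _](vgeE _ hSn) vgeD // vgeE //; lia.
Qed.

End Valuation.

(** * Residue fields *)

Definition residue_system (F : fieldType) (w : F -> int) (s : seq F) : Prop :=
  [/\ forall x, x \in s -> vge w 0 x,
      forall x y, x \in s -> y \in s -> vge w 1 (x - y) -> x = y
    & forall x, vge w 0 x -> exists2 y, y \in s & vge w 1 (x - y)].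

(** The carrier is the list of representatives itself, which yields finiteness at once and avoids a
    quotient; [hw] and [hs] are parameters so that the field operations can be attached to the
    type. *)
Definition resfield (F : fieldType) (w : F -> int) (hw : is_val w) (s : seq F)
  (hs : residue_system w s) : Type := seq_sub s.

Section ResidueField.
Variables (F : fieldType) (w : F -> int) (hw : is_val w) (s : seq F).
Hypothesis hs : residue_system w s.
Local Notation vg := (vge w).
Local Notation K := (resfield hw hs).

HB.instance Definition _ := Finite.on K.

Let lift (a : K) : F := ssval a.

(** The boolean implication makes [residue] a total function, with an arbitrary value outside the
    valuation ring. *)
Fact rep_subproof (x : F) : exists a : K, vg 0 x ==> vg 1 (x - lift a).
Proof.
have [hx|hx] := boolP (vg 0 x).
  by have [_ _ /(_ x hx)[y ys hy]] := hs; exists (SeqSub ys); rewrite ?hy ?implybT // (negPf hx).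
by have [_ _ /(_ 0 (vge0 _ _))[y ys hy]] := hs; exists (SeqSub ys); rewrite ?hy ?implybT // (negPf hx).
Qed.

Definition residue (x : F) : K := xchoose (rep_subproof x).
Local Notation rho := residue.

Let lift0 a : vg 0 (lift a).
Proof. by have [h _ _] := hs; apply: h; apply: ssvalP. Qed.

Let rhoP x : vg 0 x -> vg 1 (x - lift (rho x)).
Proof. exact/implyP/(xchooseP (rep_subproof x)). Qed.

Lemma residue_eqP x y : vg 0 x -> vg 0 y -> rho x = rho y <-> vg 1 (x - y).
Proof.
move=> hx hy; split=> [E|h].
  apply: (vge_sub_trans hw (rhoP hx)); rewrite E vge_subC //; exact: rhoP.
have [_ h2 _] := hs; apply: val_inj; apply: h2; try exact: ssvalP.
apply: (vge_sub_trans hw (y := x)); first by rewrite vge_subC //; apply: rhoP.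
exact: (vge_sub_trans hw h (rhoP hy)).
Qed.

Let rhoK a : rho (lift a) = a.
Proof.
have [_ h2 _] := hs; apply: val_inj; apply: h2; try exact: ssvalP.
by rewrite vge_subC //; apply: rhoP.
Qed.

Lemma residue_surj a : exists2 x, vg 0 x & rho x = a.
Proof. by exists (lift a). Qed.

Let add a b := rho (lift a + lift b).
Let opp a := rho (- lift a).
Let mul a b := rho (lift a * lift b).
Let inv a := if a == rho 0 then rho 0 else rho (lift a)^-1.

Let addE x y : vg 0 x -> vg 0 y -> add (rho x) (rho y) = rho (x + y).
Proof.
move=> hx hy; apply/residue_eqP; [exact: vgeD | exact: vgeD |].
by rewrite opprD addrACA vgeD // vge_subC //; apply: rhoP.
Qed.

Let oppE x : vg 0 x -> opp (rho x) = rho (- x).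
Proof.
move=> hx; apply/residue_eqP; [by rewrite vgeN | by rewrite vgeN |].
by rewrite -opprD vgeN // vge_subC //; apply: rhoP.
Qed.

Let mulE x y : vg 0 x -> vg 0 y -> mul (rho x) (rho y) = rho (x * y).
Proof.
move=> hx hy; apply/residue_eqP; [exact: vgeMl | exact: vgeMl |].
rewrite vge_subC // (_ : _ - _ = (x - lift (rho x)) * y + lift (rho x) * (y - lift (rho y))).
  by apply: vgeD => //; [apply: vgeMr|apply: vgeMl] => //; apply: rhoP.
by rewrite mulrBl mulrBr addrA subrK.
Qed.

(** Every class is the residue of an integral element, so the field axioms reduce to the same
    identities in F. *)
Let ind (P : K -> Prop) : (forall x, vg 0 x -> P (rho x)) -> forall a, P a.
Proof. by move=> h a; rewrite -(rhoK a); apply: h. Qed.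

Let z0 := vge0 w 0.
Let i1 := vge1 hw.

Fact resadd_assoc : associative add.
Proof. by do 3!elim/ind=> ? ?; rewrite !addE ?vgeD // addrA. Qed.
Fact resadd_comm : commutative add.
Proof. by do 2!elim/ind=> ? ?; rewrite !addE // addrC. Qed.
Fact resadd_left_id : left_id (rho 0) add.
Proof. by elim/ind=> ? ?; rewrite addE // add0r. Qed.
Fact resadd_left_inverse : left_inverse (rho 0) opp add.
Proof. by elim/ind=> ? ?; rewrite oppE // addE ?vgeN // addNr. Qed.
Fact resmul_assoc : associative mul.
Proof. by do 3!elim/ind=> ? ?; rewrite !mulE ?vgeMl // mulrA. Qed.
Fact resmul_comm : commutative mul.
Proof. by do 2!elim/ind=> ? ?; rewrite !mulE // mulrC. Qed.
Fact resmul_left_id : left_id (rho 1) mul.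
Proof. by elim/ind=> ? ?; rewrite mulE // mul1r. Qed.
Fact resmul_left_distributive : left_distributive mul add.
Proof. by do 3!elim/ind=> ? ?; rewrite !(addE, mulE) ?vgeMl ?vgeD // mulrDl. Qed.
Fact res_one_neq0 : rho 1 != rho 0.
Proof.
apply/eqP => /(residue_eqP i1 z0).
by rewrite subr0 vgeE ?oner_eq0 // vw1.
Qed.
Fact res_mulVf a : a != rho 0 -> mul (inv a) a = rho 1.
Proof.
move=> a0; rewrite /inv (negPf a0) -{2}(rhoK a).
have h : ~~ vg 1 (lift a).
  apply: contraNN a0 => h; rewrite -(rhoK a); apply/eqP/residue_eqP => //.
  by rewrite subr0.
have [l0 _] := vge_unit (lift0 a) h.
by rewrite mulE ?mulVf // vge_unitV.
Qed.
Fact res_inv0 : inv (rho 0) = rho 0.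
Proof. by rewrite /inv eqxx. Qed.

HB.instance Definition _ := GRing.isZmodule.Build K
  resadd_assoc resadd_comm resadd_left_id resadd_left_inverse.
HB.instance Definition _ := GRing.Zmodule_isComNzRing.Build K
  resmul_assoc resmul_comm resmul_left_id resmul_left_distributive res_one_neq0.
HB.instance Definition _ := GRing.ComNzRing_isField.Build K res_mulVf res_inv0.

Lemma residueD x y : vg 0 x -> vg 0 y -> rho (x + y) = rho x + rho y.
Proof. by move=> hx hy; rewrite -addE. Qed.
Lemma residueM x y : vg 0 x -> vg 0 y -> rho (x * y) = rho x * rho y.
Proof. by move=> hx hy; rewrite -mulE. Qed.
Lemma residue1 : rho 1 = 1. Proof. by []. Qed.
Lemma card_resfield : uniq s -> #|{: K}| = size s.
Proof. exact: card_seq_sub. Qed.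
End ResidueField.

(** The interface hides the choice of representatives. The map is defined on all of F, hence the
    laws are restricted to integral arguments. *)
Record residue_map (F : fieldType) (w : F -> int) (K : finFieldType) := ResidueMap {
  rmap :> F -> K;
  rmapD : forall x y, vge w 0 x -> vge w 0 y -> rmap (x + y) = rmap x + rmap y;
  rmapM : forall x y, vge w 0 x -> vge w 0 y -> rmap (x * y) = rmap x * rmap y;
  rmap1 : rmap 1 = 1;
  rmap_eqP : forall x y, vge w 0 x -> vge w 0 y -> rmap x = rmap y <-> vge w 1 (x - y);
  rmap_surj : forall a, exists2 x, vge w 0 x & rmap x = a }.

Lemma exists_residue_map (F : fieldType) (w : F -> int) q : is_val w -> res_card w q ->
  exists (K : finFieldType) (rho : residue_map w K), #|K| = q.
Proof.
move=> hw [s [sz su si sinj ssur]].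
have hs : residue_system w s.
  split=> [x /si/vintP//|x y xs ys /vcongP|x /vintP/ssur[y ys /vcongP]]; first exact: sinj.
  by exists y.
exists (resfield hw hs).
exists (@ResidueMap F w (resfield hw hs) (residue hw hs) (@residueD _ _ _ _ _)
  (@residueM _ _ _ _ _) (@residue1 _ _ _ _ _) (@residue_eqP _ _ _ _ _) (@residue_surj _ _ _ _ _)).
by rewrite -sz; apply: card_resfield.
Qed.

Section ResidueMap.
Variables (F : fieldType) (w : F -> int) (hw : is_val w) (K : finFieldType).
Variable rho : residue_map w K.
Local Notation vg := (vge w).

Lemma rmap0 : rho 0 = 0.
Proof.
have h := rmapD rho (vge0 w 0) (vge0 w 0).
by move: h; rewrite addr0 => /eqP; rewrite -subr_eq subrr eq_sym => /eqP.
Qed.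

Lemma rmap_eq0 x : vg 0 x -> (rho x == 0) = vg 1 x.
Proof.
move=> hx; rewrite -rmap0; apply/eqP/idP; first by move/rmap_eqP; rewrite subr0; apply; rewrite ?vge0.
by move=> h; apply/rmap_eqP; rewrite ?vge0 ?subr0.
Qed.

Lemma rmapX x n : vg 0 x -> rho (x ^+ n) = rho x ^+ n.
Proof.
by move=> hx; elim: n => [|n IH]; rewrite ?rmap1 // !exprS rmapM ?IH ?vgeX.
Qed.

Lemma rmap_sum (I : Type) (r : seq I) (P : pred I) (G : I -> F) :
  (forall i, P i -> vg 0 (G i)) -> rho (\sum_(i <- r | P i) G i) = \sum_(i <- r | P i) rho (G i).
Proof.
move=> h; have [] // : vg 0 (\sum_(i <- r | P i) G i) /\
  rho (\sum_(i <- r | P i) G i) = \sum_(i <- r | P i) rho (G i).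
elim/big_ind2: _ => [|x a y b [hx <-] [hy <-]|i Pi]; rewrite ?vge0 ?rmap0 //.
  by rewrite vgeD ?rmapD.
by rewrite h.
Qed.

Lemma rmap_nat n : rho n%:R = n%:R.
Proof.
elim: n => [|n IH]; first exact: rmap0.
by rewrite -!natr1 rmapD ?vge_nat ?vge1 // IH rmap1.
Qed.

Lemma vge_frobenius x : vg 0 x -> vg 1 (x ^+ #|K| - x).
Proof.
by move=> hx; apply/(rmap_eqP rho); rewrite ?vgeX // rmapX // expf_card.
Qed.

(** Reduction gives a polynomial of size at most d over the residue field with at least d distinct
    roots, hence the zero polynomial. *)
Lemma residue_roots d (a : nat -> F) (r : seq F) :
  (forall i, (i < d)%N -> vg 0 (a i)) -> (d <= size r)%N -> uniq r ->
  (forall x, x \in r -> vg 0 x) ->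
  (forall x y, x \in r -> y \in r -> vg 1 (x - y) -> x = y) ->
  (forall x, x \in r -> vg 1 (\sum_(i < d) a i * x ^+ i)) ->
  forall i, (i < d)%N -> vg 1 (a i).
Proof.
move=> ha sr ur ir injr rr i hi.
pose p := \poly_(i < d) rho (a i).
have p0 : p = 0.
  apply/eqP; apply: contraT => p0.
  have : (size [seq rho x | x <- r] < size p)%N.
    apply: max_poly_roots => //.
      apply/allP => _ /mapP[x xr ->]; apply/rootP.
      rewrite /p horner_poly.
      have := rr x xr; rewrite -rmap_eq0; last first.
        by apply: vge_sum => // j _; apply: vgeMl; rewrite ?vgeX ?ha ?ir.
      move/eqP => E0; rewrite -[RHS]E0 {E0} rmap_sum => [|j _];
        last by apply: vgeMl; rewrite ?vgeX ?ha ?ir.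
      by apply: eq_bigr => j _; rewrite rmapM ?rmapX ?vgeX ?ha ?ir.
    rewrite map_inj_in_uniq // => x y xr yr /rmap_eqP h; apply: injr => //; apply: h; exact: ir.
  rewrite size_map => h; have := leq_trans h (size_poly d _).
  by rewrite ltnNge sr.
by rewrite -rmap_eq0 ?ha //; have := coef_poly d (fun i => rho (a i)) i; rewrite -/p p0 coef0 hi => <-.
Qed.
End ResidueMap.

(** * Extensions of a complete discretely valued field *)

Lemma vwXz (F : fieldType) (w : F -> int) (x : F) (n : int) : is_val w -> x != 0 ->
  w (x ^ n) = n * w x.
Proof.
move=> hw x0; case: n => n; first exact: vwX.
by rewrite /exprz vwV ?expf_neq0 // vwX // NegzE; lia.
Qed.

Section LocalExtension.
Variables (k : fieldType) (v : k -> int).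
Hypotheses (hv : is_val v) (kc : vcomplete v).
Variable pi : k.
Hypotheses (pi0 : pi != 0) (vpi : v pi = 1).

Lemma vge_piX n : vge v n%:Z (pi ^+ n).
Proof. by rewrite vgeE ?expf_neq0 // vwX // vpi mulr1. Qed.

Lemma base_series (c : nat -> k) : (forall n, vge v 0 (c n)) ->
  exists y, forall N : nat, vge v N%:Z (y - \sum_(n < N) pi ^+ n * c n).
Proof.
move=> hc; pose u N := \sum_(n < N) pi ^+ n * c n.
have hu M m : (M <= m)%N -> vge v M%:Z (u m - u M).
  move=> h; rewrite -(subnKC h); elim: (m - M)%N => [|i IH]; first by rewrite addn0 subrr vge0.
  rewrite addnS /u big_ord_recr /= -/(u _) addrAC vgeD //.
  by apply: vgeMr => //; apply: vgew (vge_piX _); lia.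
have [|l hl] := kc (u := u).
  move=> N; exists `|N|%N => m n hm hn.
  have := vgeB hv (hu _ _ hm) (hu _ _ hn).
  rewrite opprB addrA subrK {1}/vge subr_eq0 => /orP[/eqP|h]; [by left|right; apply: le_trans h; lia].
exists l => N; have [M hM] := hl N%:Z.
have h1 : vge v N%:Z (l - u (maxn M N)).
  have [->|h] := hM (maxn M N) (leq_maxl _ _); first by rewrite subrr vge0.
  by rewrite vge_subC // /vge h orbT.
by apply: (vge_sub_trans hv h1); apply: hu; apply: leq_maxr.
Qed.

(** Unlike [ext_val], this is stable under restriction to a subfield, where e need no longer be the
    ramification index. *)
Definition ext_pval (L : fieldExtType k) (w : L -> int) (e : nat) : Prop :=
  is_val w /\ forall a : k, a != 0 -> w a%:A = e%:Z * v a.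

(** Since pi has valuation e in L, the list B represents the valuation ring modulo pi, possibly with
    repetitions. *)
Definition digits (L : fieldExtType k) (w : L -> int) (e : nat) (B : seq L) : Prop :=
  (forall b, b \in B -> vge w 0 b) /\
  forall x, vge w 0 x -> exists2 b, b \in B & vge w e%:Z (x - b).

Section Digits.
Variables (L : fieldExtType k) (w : L -> int) (e : nat) (e0 : (0 < e)%N).
Hypothesis hw : ext_pval w e.

Let wv : is_val w := hw.1.

Lemma vge_alg N a : vge v N a -> vge w (e%:Z * N) a%:A.
Proof.
rewrite /vge; have [->|a0 /=] := eqVneq a 0; first by rewrite scale0r eqxx.
by move=> h; rewrite hw.2 //; apply/orP; right; clear -h; nia.
Qed.

Lemma vge_algZ N M a x : vge v N a -> vge w M x -> vge w (e%:Z * N + M) (a *: x).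
Proof.
by move=> ha hx; rewrite -[x in a *: x]mul1r scalerAl; apply: vgeM => //; apply: vge_alg.
Qed.

Lemma vge_Zpi (n : nat) x : vge w (e%:Z * n%:Z) x -> vge w 0 (pi ^- n *: x).
Proof.
move=> hx; have := @vge_algZ (- n%:Z) _ (pi ^- n) x _ hx.
rewrite mulrN addNr; apply; rewrite vgeE ?invr_eq0 ?expf_neq0 //.
by rewrite vwV ?expf_neq0 // vwX // vpi mulr1.
Qed.

Lemma vge_alle x : (forall n : nat, vge w (e%:Z * n%:Z) x) -> x = 0.
Proof. by move=> h; apply: (vge_all (w := w)) => n; apply: vgew (h n); clear -e0; nia. Qed.

Variable B : seq L.
Hypothesis hB : digits w e B.

(* Expand x = \sum_n pi ^+ n * b_n with b_n in B and collect the powers of pi by digit: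
   the coefficient of each digit converges in k. *)
Lemma digits_span x : vge w 0 x -> exists c : 'I_(size B) -> k,
  (forall i, vge v 0 (c i)) /\ x = \sum_i c i *: B`_i.
Proof.
move=> hx.
pose idx y := find (fun b => vge w e%:Z (y - b)) B.
(* [X n] is the n-th remainder: x minus its first n digits, divided by pi ^+ n. *)
pose X := fix X n := if n is m.+1 then pi^-1 *: (X m - B`_(idx (X m))) else x.
have idxP y : vge w 0 y -> (idx y < size B)%N /\ vge w e%:Z (y - B`_(idx y)).
  move=> hy; have h : has (fun b => vge w e%:Z (y - b)) B.
    by case: hB => _ /(_ y hy)[b bB hb]; apply/hasP; exists b.
  by split; [rewrite -has_find | apply: (nth_find 0 h)].
have hX n : vge w 0 (X n).
  elim: n => [//|n IH] /=; have := @vge_Zpi 1 (X n - B`_(idx (X n))).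
  by rewrite mulr1 expr1; apply; have [] := idxP _ IH.
have xE N : x = \sum_(n < N) pi ^+ n *: B`_(idx (X n)) + pi ^+ N *: X N.
  elim: N => [|N IH]; first by rewrite big_ord0 add0r expr0 scale1r.
  rewrite {1}IH big_ord_recr /= scalerA exprSr mulfK // scalerBr -addrA; congr (_ + _).
  by rewrite addrC subrK.
have [c hc] : exists c : 'I_(size B) -> k, forall i, forall N : nat,
    vge v N%:Z (c i - \sum_(n < N) pi ^+ n * (idx (X n) == i)%:R).
  apply: (fin_all_exists (U := fun _ => k) (P := fun (i : 'I_(size B)) (c : k) => forall N : nat,
    vge v N%:Z (c - \sum_(n < N) pi ^+ n * (idx (X n) == i)%:R))) => i.
  have := @base_series (fun n => (idx (X n) == i)%:R); apply=> n; exact: vge_nat.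
exists c; split.
  by move=> i; have := hc i 0; rewrite big_ord0 subr0.
apply/eqP; rewrite -subr_eq0; apply/eqP; apply: vge_alle => N.
rewrite {1}(xE N).
have -> : \sum_(n < N) pi ^+ n *: B`_(idx (X n)) =
  \sum_(i < size B) (\sum_(n < N) pi ^+ n * (idx (X n) == i)%:R) *: B`_i.
  under [RHS]eq_bigr do rewrite scaler_suml.
  rewrite exchange_big /=; apply: eq_bigr => n _.
  have [hi _] := idxP _ (hX n).
  rewrite (bigD1 (Ordinal hi)) //= eqxx mulr1 big1 ?addr0 // => i.
  by rewrite eq_sym -val_eqE /= => /negPf ->; rewrite mulr0 scale0r.
rewrite addrAC -sumrB; apply: vgeD => //.
  apply: vge_sum => // i _; rewrite -scalerBl -opprB scaleNr vgeN //.
  rewrite -[_ * _]addr0; apply: vge_algZ; first exact: hc.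
  by case: hB => + _; apply; apply: mem_nth.
by rewrite -[_ * _]addr0; apply: vge_algZ => //; apply: vge_piX.
Qed.

(** This is the completeness of L: with coordinates along the digits chosen for every term, each
    coordinate series converges in k. *)
Lemma ext_series (x : nat -> L) : (forall n, vge w 0 (x n)) ->
  exists y, forall N : nat, vge w (e%:Z * N%:Z) (y - \sum_(n < N) pi ^+ n *: x n).
Proof.
move=> hx.
pose c n := proj1_sig (constructive_indefinite_description _ (digits_span (hx n))).
have cP n : (forall i, vge v 0 (c n i)) /\ x n = \sum_i c n i *: B`_i.
  exact: (proj2_sig (constructive_indefinite_description _ (digits_span (hx n)))).
have [d hd] : exists d : 'I_(size B) -> k, forall i, forall N : nat,
    vge v N%:Z (d i - \sum_(n < N) pi ^+ n * c n i).
  apply: (fin_all_exists (U := fun _ => k) (P := fun (i : 'I_(size B)) (d : k) => forall N : nat,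
    vge v N%:Z (d - \sum_(n < N) pi ^+ n * c n i))) => i.
  by have := @base_series (fun n => c n i); apply=> n; have [] := cP n.
exists (\sum_i d i *: B`_i) => N.
have -> : \sum_(n < N) pi ^+ n *: x n = \sum_(i < size B) (\sum_(n < N) pi ^+ n * c n i) *: B`_i.
  under [RHS]eq_bigr do rewrite scaler_suml.
  rewrite exchange_big /=; apply: eq_bigr => n _.
  by rewrite {1}(cP n).2 scaler_sumr; apply: eq_bigr => i _; rewrite scalerA.
rewrite -sumrB; apply: vge_sum => // i _; rewrite -scalerBl.
rewrite -[_ * _]addr0; apply: vge_algZ; first exact: hd.
by case: hB => + _; apply; apply: mem_nth.
Qed.

(* By digits_span, w2 is bounded below by a constant C on the w-integral elements; applied to
   all powers of x ^+ e * pi ^ (- w x), a w-unit, and of its inverse, this makes it a w2-unit. *)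
Lemma vw_unique (w2 : L -> int) e2 : ext_pval w2 e2 ->
  forall x, x != 0 -> e%:Z * w2 x = e2%:Z * w x.
Proof.
move=> [w2v hw2] x x0.
have piA0 : pi%:A != 0 :> L by rewrite scaler_eq0 oner_eq0 orbF.
have [C hC] : exists C : nat, forall b, b \in B -> vge w2 (- C%:Z) b.
  elim: (B) => [|b r [C IH]]; first by exists 0.
  exists (maxn C `|w2 b|) => b'; rewrite inE => /orP[/eqP ->|/IH]; last by apply: vgew; lia.
  by rewrite /vge; apply/orP; right; lia.
have hint y : vge w 0 y -> vge w2 (- C%:Z) y.
  move/digits_span => [c [hc ->]]; apply: vge_sum => // i _.
  rewrite -[B`_i]mul1r scalerAl; apply: vgeMl => //; last by apply/hC/mem_nth.
  have := hc i; rewrite /vge; have [->|c0] := eqVneq (c i) 0; first by rewrite scale0r eqxx.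
  by move=> /= h; rewrite hw2 //; apply/orP; right; nia.
have hle z : z != 0 -> w z = 0 -> 0 <= w2 z.
  move=> z0 wz; rewrite leNgt; apply/negP => h.
  have := hint (z ^+ C.+1); rewrite !vgeE ?expf_neq0 // !vwX // wz mulr0 => /(_ (lexx _)); nia.
pose y := x ^+ e * pi%:A ^ (- w x).
have piz0 : (pi%:A : L) ^ (- w x) != 0 by apply: expfz_neq0.
have y0 : y != 0 by rewrite mulf_neq0 // expf_neq0.
have wy : w y = 0 by rewrite /y vwM ?expf_neq0 // vwX // vwXz // hw.2 // vpi; lia.
have w2y : w2 y = e%:Z * w2 x - e2%:Z * w x.
  by rewrite /y vwM ?expf_neq0 // vwX // vwXz // hw2 // vpi; lia.
have h1 := hle y y0 wy.
have h2 : 0 <= w2 y^-1 by apply: hle; rewrite ?invr_eq0 // vwV // wy.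
move: h2; rewrite vwV //; lia.
Qed.

Variable Q : nat.
Hypothesis hQ1 : forall x, vge w 0 x -> vge w 1 (x ^+ Q - x).
Hypothesis hQ0 : vge w 1 Q%:R.

(** The cofactor of x - y is a sum of Q monomials, each congruent to x ^+ Q.-1 modulo the maximal
    ideal; it is thus congruent to Q x ^+ Q.-1, hence to 0, and one unit of valuation is gained. Q
    stays abstract because the order of the residue field of E is also used on subfields. *)
Lemma vge_powQ n x y : vge w 0 x -> vge w 0 y -> vge w n.+1%:Z (x - y) ->
  vge w n.+2%:Z (x ^+ Q - y ^+ Q).
Proof.
clear hB B e0 pi0 vpi; move=> hx hy h; rewrite subrXX (_ : n.+2%:Z = n.+1%:Z + 1); last lia.
apply: vgeM => //; rewrite (_ : \sum_(i < Q) _ =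
  \sum_(i < Q) (x ^+ (Q.-1 - i) * y ^+ i - x ^+ Q.-1) + Q%:R * x ^+ Q.-1); last first.
  by rewrite sumrB sumr_const card_ord mulr_natl subrK.
apply: vgeD => //; last by apply: vgeMr => //; apply: vgeX.
apply: vge_sum => // i _.
have hi : (i <= Q.-1)%N by have := ltn_ord i; lia.
rewrite -{2}(subnK hi) exprD -mulrBr; apply: vgeMl; rewrite ?vgeX //.
by rewrite vge_subC // vge_subX //; apply: vgew h; lia.
Qed.

(* t is the limit of the subsequence x ^+ (Q ^ (e * n)), whose n-th increment is divisible
   by pi ^+ n. *)
Lemma teichmueller x : vge w 0 x -> exists2 t, t ^+ Q = t & vge w 1 (t - x).
Proof.
move=> hx; pose u n := x ^+ (Q ^ n).
have hu n : vge w 0 (u n) by apply: vgeX.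
have uS n : u n.+1 = u n ^+ Q by rewrite /u expnSr exprM.
have du n : vge w n.+1%:Z (u n.+1 - u n).
  elim: n => [|n IH]; first by rewrite uS hQ1.
  by rewrite uS [u n.+1]uS; apply: vge_powQ => //; rewrite -uS.
have du2 n m : (n <= m)%N -> vge w n.+1%:Z (u m - u n).
  move=> h; rewrite -(subnKC h); elim: (m - n)%N => [|i IH]; first by rewrite addn0 subrr vge0.
  by apply: (vge_sub_trans wv _ IH); rewrite addnS; apply: vgew (du _); lia.
pose z n := pi ^- n *: (u (e * n.+1)%N - u (e * n)%N).
have hz n : vge w 0 (z n).
  by apply: vge_Zpi; apply: vgew (du2 (e * n)%N (e * n.+1)%N _); lia.
have sz N : \sum_(n < N) pi ^+ n *: z n = u (e * N)%N - u 0.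
  elim: N => [|N IH]; first by rewrite big_ord0 muln0 subrr.
  rewrite big_ord_recr /= IH /z scalerA divff ?expf_neq0 // scale1r.
  by rewrite addrC addrA subrK.
have [y hy] := ext_series hz.
pose t := y + u 0.
have ht N : vge w (e * N)%N%:Z (t - u (e * N)%N).
  by rewrite PoszM; have := hy N; rewrite sz opprB addrA.
have t1 : vge w 1 (t - x).
  apply: (vge_sub_trans wv (y := u (e * 1)%N)); first by apply: vgew (ht 1%N); lia.
  by have := du2 0 (e * 1)%N isT; rewrite {2}/u expn0 expr1.
have t0 : vge w 0 t by rewrite (vge_subr wv (x := x)) // vge_subC //; apply: vgew t1; lia.
exists t => //; apply/eqP; rewrite -subr_eq0; apply/eqP; apply: vge_alle => N.
rewrite -PoszM; apply: (vge_sub_trans wv (y := u (e * N)%N.+1)).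
  by rewrite uS; apply: vge_subX.
apply: (vge_sub_trans wv (y := u (e * N)%N)); last by rewrite vge_subC.
by apply: vgew (du _); lia.
Qed.

End Digits.

(** A plain function with laws covers inclusions of [subvs_of], restrictions of automorphisms and
    the factors of a tensor product alike. *)
Definition kembedding (L E : fieldExtType k) (j : L -> E) : Prop :=
  [/\ forall a x y, j (a *: x - y) = a *: j x - j y, j 1 = 1
    & forall x y, j (x * y) = j x * j y].

Section Embedding.
Variables (L E : fieldExtType k) (j : L -> E) (hj : kembedding j).

Lemma kembB x y : j (x - y) = j x - j y.
Proof. by case: hj => h _ _; have := h 1 x y; rewrite !scale1r. Qed.
Lemma kemb0 : j 0 = 0. Proof. by rewrite -(subrr 0) kembB subrr. Qed.
Lemma kembD x y : j (x + y) = j x + j y.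
Proof. by rewrite -{1}[y]opprK kembB -[- y]sub0r (kembB 0) kemb0 sub0r opprK. Qed.
Lemma kembZ a x : j (a *: x) = a *: j x.
Proof. by case: hj => h _ _; have := h a x 0; rewrite kemb0 !subr0. Qed.
Lemma kembM x y : j (x * y) = j x * j y. Proof. by case: hj. Qed.
Lemma kemb1 : j 1 = 1. Proof. by case: hj. Qed.
Lemma kembX x n : j (x ^+ n) = j x ^+ n.
Proof. by elim: n => [|n IH]; rewrite ?kemb1 // !exprS kembM IH. Qed.
Lemma kemb_alg a : j a%:A = a%:A. Proof. by rewrite kembZ kemb1. Qed.
Lemma kemb_eq0 x : (j x == 0) = (x == 0).
Proof.
apply/idP/idP => [|/eqP ->]; last by rewrite kemb0.
apply: contraLR => x0; apply/eqP => jx.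
by have := kemb1; rewrite -(divff x0) kembM jx mul0r => /eqP; rewrite eq_sym oner_eq0.
Qed.
Lemma kemb_inj : injective j.
Proof. by move=> x y /eqP; rewrite -subr_eq0 -kembB kemb_eq0 subr_eq0 => /eqP. Qed.

Variables (w : E -> int) (e : nat) (hw : ext_pval w e).

Lemma vge_comp N x : vge (w \o j) N x = vge w N (j x).
Proof. by rewrite /vge kemb_eq0. Qed.

Lemma ext_pval_comp : ext_pval (w \o j) e.
Proof.
case: hw => [[h1 h2] h3]; split=> [|a a0 /=]; last by rewrite kemb_alg h3.
split=> x y x0 y0; first by rewrite /= kembM h1 ?kemb_eq0.
by move=> s0; rewrite /= kembD h2 // ?kemb_eq0 // -kembD kemb_eq0.
Qed.

(** A digit close to the image of an integral element of L is replaced by such an element, the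
    others are dropped, and the triangle inequality does the rest. Subfields thus get digits before
    anything is known of their residue fields. *)
Lemma digits_comp B : digits w e B -> exists B', digits (w \o j) e B'.
Proof.
case: hw => wv _ [_ hB].
suff [B' [h1 h2]] : exists B' : seq L, (forall b, b \in B' -> vge w 0 (j b)) /\
    forall x, vge w 0 (j x) -> (exists2 b, b \in B & vge w e%:Z (j x - b)) ->
      exists2 b, b \in B' & vge w e%:Z (j (x - b)).
  exists B'; split=> [b /h1|x]; rewrite vge_comp // => hx.
  by have [b bB hb] := h2 x hx (hB _ hx); exists b => //; rewrite vge_comp.
elim: B {hB} => [|b r [B' [h1 h2]]]; first by exists [::]; split=> // x _ [].
have [[y hy hyb]|hno] := classic (exists2 y, vge w 0 (j y) & vge w e%:Z (j y - b)).
  exists (y :: B'); split=> [b'|x hx [b' + hb']].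
    by rewrite inE => /orP[/eqP ->|/h1].
  rewrite inE => /orP[/eqP E1|b'r].
    exists y; first by rewrite mem_head.
    rewrite kembB; apply: (vge_sub_trans wv hb'); rewrite E1 vge_subC //.
  have [b2 b2B hb2] := h2 x hx (ex_intro2 _ _ b' b'r hb').
  by exists b2 => //; rewrite inE b2B orbT.
exists B'; split=> // x hx [b' + hb']; rewrite inE => /orP[/eqP E1|b'r].
  by case: hno; exists x => //; rewrite -E1.
by apply: h2 => //; exists b'.
Qed.
End Embedding.

(** The digits are truncated expansions in the uniformizer p. Their shape is recorded because
    [dim_ext] reads off from it that the powers of p span E over k(z). *)
Lemma exists_digits (E : fieldExtType k) (w : E -> int) (p : E) (s : seq E) (e : nat) :
  is_val w -> p != 0 -> w p = 1 -> (forall x, x \in s -> vge w 0 x) ->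
  (forall x, vge w 0 x -> exists2 y, y \in s & vge w 1 (x - y)) ->
  exists2 B, digits w e B & forall b, b \in B ->
    exists2 c : nat -> E, (forall i, c i \in s) & b = \sum_(i < e) c i * p ^+ i.
Proof.
clear pi0 vpi; move=> wv p0 wp si ssur.
have hp n : vge w n%:Z (p ^+ n) by rewrite vgeE ?expf_neq0 // vwX // wp mulr1.
have [s0 s0s _] := ssur 0 (vge0 w 0).
elim: e => [|e [B [h1 h2] h3]].
  exists [:: 0]; last by move=> b; rewrite inE => /eqP ->; exists (fun=> s0); rewrite ?big_ord0.
  split=> [b|x hx]; first by rewrite inE => /eqP ->; rewrite vge0.
  by exists 0; rewrite ?mem_head // subr0.
exists [seq b + c * p ^+ e | b <- B, c <- s]; last first.
  move=> _ /allpairsP[[b c] /= [bB cs ->]]; have [d hd ->] := h3 b bB.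
  exists (fun i => if (i < e)%N then d i else c) => [i|]; first by case: ifP.
  rewrite big_ord_recr /= ltnn; congr (_ + _).
  by apply: eq_bigr => i _; rewrite ltn_ord.
split.
  move=> _ /allpairsP[[b c] /= [bB cs ->]]; apply: (vgeD wv); first exact: h1.
  by apply: (vgeMl wv); [exact: si | apply: vgew (hp e)].
move=> x hx; have [b bB hb] := h2 x hx.
have hy : vge w 0 ((x - b) / p ^+ e).
  have := vgeM wv hb (y := (p ^+ e)^-1) (M := - e%:Z); rewrite subrr; apply.
  by rewrite vgeE ?invr_eq0 ?expf_neq0 // vwV ?expf_neq0 // vwX // wp mulr1.
have [c cs hc] := ssur _ hy.
exists (b + c * p ^+ e); first by apply/allpairsP; exists (b, c).
rewrite opprD addrA (_ : _ - _ = p ^+ e * ((x - b) / p ^+ e - c)); last first.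
  by rewrite mulrBr mulrCA divff ?expf_neq0 // mulr1 (mulrC c).
by rewrite (_ : e.+1%:Z = e%:Z + 1); [apply: vgeM | lia].
Qed.

End LocalExtension.

(** * Automorphisms of finite extensions *)

Section Automorphisms.
Import FalgLfun.
Variables (k : fieldType) (E : fieldExtType k).
Implicit Types (g h : 'End(E)) (H : seq 'End(E)).

Lemma autkP g : reflect (g 1 = 1 /\ forall x y, g (x * y) = g x * g y) (autk g).
Proof.
rewrite /autk kAutfE; apply: (iffP kHomP_tmp) => [[h1 h2]|[h1 h2]].
  by split=> [|x y]; [apply: h1; apply: mem1v | apply: h2; apply: memvf].
by split=> [_ /vlineP[c ->]|x y _ _]; rewrite ?linearZ /= ?h1.
Qed.

Lemma autk_kHom g : autk g = kHom 1 {:E} g.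
Proof. by rewrite /autk kAutfE. Qed.

Lemma autkX g x n : autk g -> g (x ^+ n) = g x ^+ n.
Proof.
by case/autkP => g1 gM; elim: n => [|n IH]; rewrite ?expr0 // !exprS gM IH.
Qed.

Lemma autk1 : autk (\1%VF : 'End(E)).
Proof. by rewrite autk_kHom kHom1. Qed.

Lemma autk_comp g h : autk g -> autk h -> autk (g \o h)%VF.
Proof. by rewrite !autk_kHom => hg hh; apply: comp_kHom. Qed.

Lemma autk_inv g : autk g -> autk (g^-1)%VF.
Proof. by rewrite !autk_kHom; apply: inv_kHomf. Qed.

Lemma autk_inj g : autk g -> injective g.
Proof. by rewrite autk_kHom => /kAutf_lker0/lker0P. Qed.

Lemma autkVK g : autk g -> cancel (g^-1)%VF g.
Proof. by rewrite autk_kHom => /kAutf_lker0 h; apply: lker0_lfunVK. Qed.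

Lemma autkK g : autk g -> cancel g (g^-1)%VF.
Proof. by rewrite autk_kHom => /kAutf_lker0 h; apply: lker0_lfunK. Qed.

Lemma autk_rmorphism g : autk g -> exists G : {rmorphism E -> E}, G =1 g.
Proof.
rewrite autk_kHom => /kHom_monoid_morphism gM.
pose gmM := GRing.isMonoidMorphism.Build _ _ _ gM.
by exists (HB.pack (fun_of_lfun g) gmM : {rmorphism E -> E}).
Qed.

Lemma autk_fix_adjoin (F : {subfield E}) (z : E) g h :
  autk g -> autk h -> {in F, g =1 id} -> {in F, h =1 id} ->
  <<F; z>>%VS = fullv -> g z = h z -> g = h.
Proof.
rewrite !autk_kHom => hg hh gF hF full gz.
have kF s : kHom 1 {:E} s -> {in F, s =1 id} -> kHom F {:E} s.
  by case/kHomP_tmp => _ sM sF; apply/kHomP_tmp.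
apply/lfunP => x.
have /Fadjoin_polyP[p pF ->] : x \in <<F; z>>%VS by rewrite full memvf.
rewrite (kHom_horner hg) ?memvf ?(polyOverSv (subvf _) pF) //.
rewrite (kHom_horner hh) ?memvf ?(polyOverSv (subvf _) pF) //.
by rewrite (kHom_poly_id (kF _ hg gF) pF) (kHom_poly_id (kF _ hh hF) pF) gz.
Qed.

Lemma exists_fixed_field H : (forall g, g \in H -> autk g) ->
  exists F : {subfield E}, forall x, x \in F <-> forall g, g \in H -> g x = x.
Proof.
move=> hH.
have [V hV] : exists V : {vspace E}, forall x, x \in V <-> forall g, g \in H -> g x = x.
  elim: H {hH} => [|g H [V hV]]; first by exists fullv => x; rewrite memvf.
  exists (V :&: fixedSpace g)%VS => x; rewrite memv_cap; split.
    move=> /andP[/hV xV /fixedSpaceP gx] h; rewrite inE => /orP[/eqP ->|] //; exact: xV.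
  move=> h; apply/andP; split; last by apply/fixedSpaceP/h/mem_head.
  by apply/hV => g' g'H; apply: h; rewrite inE g'H orbT.
have aV : is_aspace V.
  apply/andP; split.
    by apply: has_algid1; apply/hV => g /hH/autkP[].
  apply/prodvP => x y /hV hx /hV hy; apply/hV => g gH.
  by have /autkP[_ ->] := hH g gH; rewrite hx ?hy.
by exists (ASpace aV).
Qed.

(* Each x is a root of the product of X - y over its orbit, so E is separable over F of
   degree at most [size H] by the primitive element theorem. *)
Lemma artin_dim H (F : {subfield E}) : uniq H -> (forall g, g \in H -> autk g) ->
  \1%VF \in H -> (forall g h, g \in H -> h \in H -> (g \o h)%VF \in H) ->
  (forall x, x \in F <-> forall g, g \in H -> g x = x) ->
  \dim {:E} = (size H * \dim F)%N.
Proof.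
move=> uH aH H1 cH hF.
pose r (x : E) : seq E := undup [seq g x | g : 'End(E) <- H].
pose p (x : E) : {poly E} := \prod_(y <- r x) ('X - y%:P).
have pF x : p x \is a polyOver F.
  apply/polyOverP => i; apply/hF => g gH.
  have [G GE] := autk_rmorphism (aH g gH).
  rewrite -GE -coef_map /p rmorph_prod /=; congr (polyseq _)`_i.
  (* g is injective and maps the orbit of x into itself, so it permutes the orbit and fixes the
     coefficients of [p x]. *)
  transitivity (\prod_(y <- [seq g y | y <- r x]) ('X - y%:P)).
    rewrite big_map (eq_bigr (fun y => 'X - (g y)%:P)) // => y _.
    by rewrite map_polyXsubC /= GE.
  apply: perm_big.
  have ug : uniq [seq g y | y <- r x].
    by rewrite map_inj_uniq ?undup_uniq //; apply: autk_inj; apply: aH.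
  apply: uniq_perm => //; first exact: undup_uniq.
  have [||//] := uniq_min_size ug (s2 := r x); last by rewrite size_map.
  move=> _ /mapP[y + ->]; rewrite !mem_undup => /mapP[h hH ->].
  by apply/mapP; exists (g \o h)%VF; [apply: cH | rewrite lfunE].
have rp x : root (p x) x.
  rewrite root_prod_XsubC mem_undup; apply/mapP; exists \1%VF => //.
  by rewrite lfunE.
have mp x : minPoly F x %| p x by apply: minPoly_dvdp.
have sepF : separable F fullv.
  apply/separableP => x _; apply: dvdp_separable (mp x) _.
  by rewrite separable_prod_XsubC undup_uniq.
have full := eq_adjoin_separable_generator sepF (subvf F).
set x := separable_generator F fullv in full.
rewrite full dim_Fadjoin; congr (_ * _)%N; apply/eqP; rewrite eqn_leq; apply/andP; split.
  rewrite -ltnS -size_minPoly; apply: leq_trans (dvdp_leq _ (mp x)) _.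
    by rewrite monic_neq0 // monic_prod_XsubC.
  by rewrite size_prod_XsubC ltnS -(size_map (fun g : 'End(E) => g x) H) size_undup.
(* Conversely, distinct elements of H send the generator x to distinct roots of its minimal
   polynomial over F. *)
rewrite -ltnS -size_minPoly -(size_map (fun g : 'End(E) => g x) H).
apply: max_poly_roots; first by rewrite monic_neq0 ?monic_minPoly.
  apply/allP => _ /mapP[g gH ->].
  apply: (kHom_root_id (subvf F)); rewrite ?minPolyOver ?memvf ?root_minPoly //.
  apply/kHomP_tmp; split=> [y /hF/(_ g gH)//|y y' _ _].
  by have /autkP[_] := aH g gH.
rewrite map_inj_in_uniq // => g h gH hH.
by apply: (autk_fix_adjoin (F := F) (aH g gH) (aH h hH)) => // y /hF; apply.
Qed.

Lemma finite_roots (p : {poly E}) : p != 0 -> exists r : seq E, forall x, root p x -> x \in r.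
Proof.
have [n] := ubnP (size p); elim: n p => // n IH p /ltnSE sp p0.
have [[a pa]|hno] := classic (exists a, root p a); last first.
  by exists [::] => x px; case: hno; exists x.
have [p' Ep] := factor_theorem p a pa.
have p'0 : p' != 0 by apply: contraNneq p0 => h; rewrite Ep h mul0r.
have [|//|r hr] := IH p'.
  by move: sp; rewrite Ep size_Mmonic ?monicXsubC // size_XsubC addn2.
exists (a :: r) => x; rewrite Ep rootM root_XsubC inE => /orP[/hr ->|->] //.
by rewrite orbT.
Qed.

(** An automorphism is determined by the images of a basis, and each image is a root of the minimal
    polynomial of the basis vector: finitely many candidates remain. *)
Lemma exists_card_aut : exists n, card_aut E n.
Proof.
pose B : seq E := vbasis {:E}.
have [cand hc] : exists c : seq (seq E), forall g, autk g -> map g B \in c.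
  elim: B => [|b B [c hc]]; first by exists [:: [::]].
  have [r hr] := finite_roots (monic_neq0 (monic_minPoly 1 b)).
  exists [seq x :: l | x <- r, l <- c] => g ag; apply/allpairsP.
  exists (g b, map g B); split=> //=; last exact: hc.
  apply: hr; move: ag; rewrite autk_kHom => ag.
  exact: (kHom_root_id (subvf _) ag (minPolyOver 1 b) (memvf b) (root_minPoly 1 b)).
have inj g h : map g B = map h B -> g = h.
  move=> /eq_in_map gh; apply/lfunP => x; rewrite (coord_vbasis (memvf x)) !linear_sum.
  apply: eq_bigr => i _; rewrite !linearZ /=; congr (_ *: _).
  by apply: gh; apply: mem_nth; rewrite size_tuple.
have [s hs] : exists s : seq 'End(E), (forall g, g \in s -> autk g) /\
    forall g, autk g -> map g B \in cand -> g \in s.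
  elim: cand {hc} => [|l c [s [s1 s2]]]; first by exists [::].
  have [[g ag gl]|hno] := classic (exists2 g, autk g & map g B = l).
    exists (g :: s); split=> h; first by rewrite inE => /orP[/eqP ->|/s1].
    move=> ah; rewrite inE -gl => /orP[/eqP/inj ->|/(s2 _ ah)]; first exact: mem_head.
    by rewrite inE orbC => ->.
  exists s; split=> // h ah; rewrite inE => /orP[/eqP E1|]; last exact: s2.
  by case: hno; exists h.
exists (size (undup s)), (undup s); split=> //; first exact: undup_uniq.
move=> g; rewrite mem_undup; apply/idP/idP; first exact: hs.1.
by move=> ag; apply: hs.2 => //; apply: hc.
Qed.

Lemma lexpS g n x : (g ^+ n.+1) x = g ((g ^+ n) x).
Proof. by rewrite exprSr lfun_mulE. Qed.

Lemma autk_exp g n : autk g -> autk (g ^+ n).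
Proof.
move=> ag; elim: n => [|n IH]; first by rewrite expr0; apply: autk1.
by rewrite exprSr -lfun_compE; apply: autk_comp.
Qed.

Lemma autk_comp_eq1 g h : autk g -> (g \o h)%VF = \1%VF -> (g^-1)%VF = h.
Proof.
move=> ag gh; apply/lfunP => x; apply: (autk_inj ag).
by rewrite autkVK //; have := congr1 (fun u : 'End(E) => u x) gh; rewrite comp_lfunE id_lfunE.
Qed.

Lemma autk_idempotent g : autk g -> (g \o g)%VF = g -> g = \1%VF.
Proof.
move=> ag gg; apply/lfunP => x; apply: (autk_inj ag); rewrite id_lfunE.
by have := congr1 (fun u : 'End(E) => u x) gg; rewrite lfunE.
Qed.

(** Pigeonhole among the powers of g. The order is phrased by [primitive_root] in the ring
    ['End(E)], so that the calculus of exponents of roots of unity applies to automorphisms. *)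
Lemma autk_order g : autk g -> exists n, n.-primitive_root g.
Proof.
move=> ag; have [N [s [_ _ hs]]] := exists_card_aut.
have [i [j [ij Eij]]] : exists i j, (i < j)%N /\ g ^+ i = g ^+ j.
  have [inj|/injectivePn[i [j ij Eij]]] := boolP (injectiveb (fun i : 'I_(size s).+1 => g ^+ i)).
    have : (size [seq g ^+ i | i : 'I_(size s).+1] <= size s)%N.
      apply: uniq_leq_size; first by rewrite map_inj_uniq ?enum_uniq //; apply/injectiveP.
      by move=> _ /mapP[i _ ->]; rewrite hs; apply: autk_exp.
    by rewrite size_map size_enum_ord ltnn.
  have [h|h|/val_inj h] := ltngtP i j; last by rewrite h eqxx in ij.
    by exists i, j.
  by exists j, i.
have g1 : g ^+ (j - i) = 1.
  apply/lfunP => x; apply: (autk_inj (autk_exp i ag)).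
  by rewrite -[LHS]lfun_mulE -exprD subnK ?(ltnW ij) // -Eij id_lfunE.
have [|m hm _] := prim_order_exists _ g1; first by rewrite subn_gt0.
by exists m.
Qed.

Lemma cyclic_fixed_field g n : autk g -> n.-primitive_root g ->
  exists2 F : {subfield E}, forall x, x \in F <-> g x = x & \dim {:E} = (n * \dim F)%N.
Proof.
move=> ag ng; have n0 := prim_order_gt0 ng.
pose H := [seq g ^+ i | i <- iota 0 n].
have HP i : g ^+ i \in H.
  by rewrite -(prim_expr_mod ng); apply: map_f; rewrite mem_iota /= add0n ltn_mod.
have aH h : h \in H -> autk h by move=> /mapP[i _ ->]; apply: autk_exp.
have [F hF] := exists_fixed_field aH.
exists F.
  move=> x; split=> [/hF/(_ _ (HP 1%N))//|gx]; apply/hF => _ /mapP[i _ ->].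
  by elim: i => [|i IH]; rewrite ?id_lfunE // lexpS IH.
rewrite -(_ : size H = n); last by rewrite size_map size_iota.
apply: (artin_dim _ aH _ _ hF).
- rewrite map_inj_in_uniq ?iota_uniq // => i j; rewrite !mem_iota /= => hi hj /eqP.
  by rewrite (eq_prim_root_expr ng) !modn_small // => /eqP.
- exact: (HP 0%N).
- by move=> _ _ /mapP[i _ ->] /mapP[j _ ->]; rewrite lfun_compE -exprD.
Qed.

End Automorphisms.

(** * Local fields *)

Lemma card_finField_pchar (K : finFieldType) :
  exists p n, [/\ p \in [pchar K], (0 < n)%N & #|K| = (p ^ n)%N].
Proof.
have [p pr cp] := finPcharP K.
exists p, (logn p #|K|); split=> //; last exact: (card_pprimeChar cp).
have cK : #|K| = (p ^ logn p #|K|)%N := card_pprimeChar cp.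
by have := finNzRing_gt1 K; rewrite {1}cK; case: (logn _ _).
Qed.

Section LocalFieldExtension.
Import FalgLfun.
Variables (k : fieldType) (v : k -> int).
Hypotheses (hv : is_val v) (kc : vcomplete v).
Variable pi : k.
Hypotheses (pi0 : pi != 0) (vpi : v pi = 1).
Variables (q : nat) (Kk : finFieldType) (rk : residue_map v Kk) (cKk : #|Kk| = q).
Variables (E : fieldExtType k) (w : E -> int) (e : nat).
Hypothesis (hw : ext_pval v w e).
Variables (pE : E) (pE0 : pE != 0) (wpE : w pE = 1).
Variables (f : nat) (KE : finFieldType) (rE : residue_map w KE) (cKE : #|KE| = (q ^ f)%N).

Let wv : is_val w := hw.1.
Local Notation Q := (q ^ f)%N.

(** If e were 0, nonzero elements of k would have valuation 0, and the nonzero terms of the minimal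
    polynomial of [pE] at [pE] would have pairwise distinct valuations, so their sum could not
    vanish. *)
Lemma ramification_gt0 : (0 < e)%N.
Proof.
rewrite lt0n; apply/negP => /eqP e0.
pose p := minPoly 1%VS pE; pose a i := p`_i * pE ^+ i.
have wa i : a i != 0 -> w (a i) = i.
  rewrite mulf_eq0 expf_eq0 (negPf pE0) andbF orbF => pi_0.
  have /polyOverP/(_ i)/vlineP[c Ec] := minPolyOver 1 pE.
  rewrite /a vwM ?expf_neq0 // vwX // wpE /p Ec hw.2 ?e0; first by lia.
  by apply: contraNneq pi_0 => c0; rewrite /p Ec c0 scale0r.
have [||] := @val_sum_distinct _ _ wv (size p) a.
- exists (size p).-1; first by rewrite /p size_minPoly.
  by rewrite /a -lead_coefE (monicP (monic_minPoly _ _)) mul1r expf_neq0.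
- by move=> i j _ _ /wa -> /wa -> [].
by rewrite /a -horner_coef minPolyxx eqxx.
Qed.
Let e0 := ramification_gt0.

Lemma q_gt1 : (1 < q)%N. Proof. by rewrite -cKk finNzRing_gt1. Qed.

Lemma Q_gt1 : (1 < Q)%N. Proof. by rewrite -cKE finNzRing_gt1. Qed.

Lemma inertia_gt0 : (0 < f)%N.
Proof. by have := Q_gt1; case: (f). Qed.

Lemma vge_alg1 a : vge v 0 a -> vge w 1 a%:A = vge v 1 a.
Proof.
rewrite /vge scaler_eq0 oner_eq0 orbF; have [//|a0 /=] := eqVneq a 0.
by move=> h; rewrite hw.2 //; have := e0; nia.
Qed.

Lemma vge_alg0 a : vge v 0 a -> vge w 0 a%:A.
Proof. by move/(vge_alg hw); rewrite mulr0. Qed.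

Lemma residue_pchar : [pchar KE].-nat q /\ vge w 1 q%:R.
Proof.
have [p [n [cp n0 cq]]] := card_finField_pchar Kk.
have p1 : vge w 1 p%:R.
  have : vge v 1 p%:R by rewrite -(rmap_eq0 rk) ?vge_nat // rmap_nat // pcharf0.
  by rewrite -vge_alg1 ?vge_nat // -in_algE rmorph_nat.

have pE' : p \in [pchar KE].
  by rewrite inE (pcharf_prime cp) /= -(rmap_nat wv rE) (rmap_eq0 rE) // vge_nat.
rewrite -cKk cq; split.
  by rewrite pnatX; apply/orP; left; rewrite pnatE // (pcharf_prime cp).
by rewrite -(prednK n0) expnS natrM; apply: vgeMr => //; apply: vge_nat.
Qed.

Lemma vge_Q1 x : vge w 0 x -> vge w 1 (x ^+ Q - x).
Proof. by rewrite -cKE; apply: vge_frobenius. Qed.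

Lemma vge_Q0 : vge w 1 Q%:R.
Proof.
rewrite -(prednK inertia_gt0) expnS natrM; apply: vgeMr; rewrite ?vge_nat //.
exact: residue_pchar.2.
Qed.

(** * Teichmueller representatives, the root of unity z and its powers *)

Lemma exists_ext_digits : exists B, digits w e B.
Proof.
have [t ht] : exists t : KE -> E, forall a, vge w 0 (t a) /\ rE (t a) = a.
  apply: (fin_all_exists (U := fun=> E) (P := fun a t => vge w 0 t /\ rE t = a)) => a.
  by have [x] := rmap_surj rE a; exists x.
have [||B hB _] := @exists_digits _ _ w pE (codom t) e wv pE0 wpE; last by exists B.
  by move=> _ /codomP[a ->]; case: (ht a).
move=> x hx; exists (t (rE x)); first exact: codom_f.
by have [h1 h2] := ht (rE x); apply/(rmap_eqP rE).
Qed.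

(** The Q-th power fixes both s and t, yet strengthens their congruence by one each time, so s - t
    has arbitrarily large valuation. *)
Lemma teichmueller_inj s t : s ^+ Q = s -> t ^+ Q = t -> vge w 1 (s - t) -> s = t.
Proof.
have int x : x ^+ Q = x -> vge w 0 x.
  have [->|x0] := eqVneq x 0; first by rewrite vge0.
  move=> /(congr1 w); rewrite vwX // vgeE // => h; have := Q_gt1; nia.
move=> hs ht h; apply/eqP; rewrite -subr_eq0; apply/eqP.
apply: (vge_all (w := w)) => n; apply: (@vgew _ _ n.+1%:Z); first lia.
elim: n => [//|n IH]; rewrite -hs -ht.
by apply: (vge_powQ hw vge_Q0) => //; apply: int.
Qed.

(** The Teichmueller lifts of the nonzero residues are Q - 1 distinct roots of X ^ (Q - 1) - 1; a
    field with that many such roots has a primitive one. *)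
Lemma exists_zeta : exists z : E, Q.-1.-primitive_root z.
Proof.
have [B hB] := exists_ext_digits.
have [t ht] : exists t : KE -> E, forall a, t a ^+ Q = t a /\ rE (t a) = a.
  apply: (fin_all_exists (U := fun=> E) (P := fun a t => t ^+ Q = t /\ rE t = a)) => a.
  have [x hx xa] := rmap_surj rE a.
  have [t tQ tx] := teichmueller hv kc pi0 vpi e0 hw hB vge_Q1 vge_Q0 hx.
  exists t; split=> //; rewrite -xa; apply/(rmap_eqP rE) => //.
  by rewrite (vge_subr wv (x := x)) // vge_subC //; apply: vgew tx.
have tinj : injective t by move=> a b /(congr1 rE); rewrite (ht a).2 (ht b).2.
pose rs := [seq t a | a <- enum (predC1 (0 : KE))].
have Q1 := Q_gt1.
have /hasP[z _ zP] : has (Q.-1).-primitive_root rs.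
  apply: has_prim_root; first by lia.
  - apply/allP => y /mapP[a]; rewrite mem_enum inE => a0 ->.
    apply/unity_rootP; have ta0 : t a != 0.
      by apply: contraNneq a0 => /(congr1 rE); rewrite (ht a).2 => ->; rewrite rmap0.
    apply: (mulfI ta0); rewrite mulr1 -exprS prednK ?(ht a).1 //; lia.
  - by rewrite map_inj_uniq ?enum_uniq.
  by rewrite size_map -cardE cardC1 cKE.
by exists z.
Qed.

Variable z : E.
Hypothesis zP : Q.-1.-primitive_root z.

Lemma zetaQ : z ^+ Q = z.
Proof. by have := Q_gt1; case: Q (prim_expr_order zP) => // n /= h _; rewrite exprS h mulr1. Qed.

Lemma zeta_neq0 : z != 0.
Proof.
apply/eqP => z0; have := prim_expr_order zP; rewrite z0 expr0n.
have -> : (Q.-1 == 0)%N = false by have := Q_gt1; lia.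
by move/eqP; rewrite eq_sym oner_eq0.
Qed.

Lemma zeta_val0 : w z = 0.
Proof.
have := congr1 w zetaQ; rewrite vwX ?zeta_neq0 // => h; have := Q_gt1; nia.
Qed.

Lemma zeta_int : vge w 0 z.
Proof. by rewrite vgeE ?zeta_neq0 // zeta_val0. Qed.

Lemma zetaX_Q n : (z ^+ n) ^+ Q = z ^+ n.
Proof. by rewrite -exprM mulnC exprM zetaQ. Qed.

Lemma zeta_conj_inj i j : (i < f)%N -> (j < f)%N -> z ^+ (q ^ i) = z ^+ (q ^ j) -> i = j.
Proof.
(* The bound needs 1 < f: it fails for q = 2 and f = 1. When f = 1, both i and j are 0. *)
have hlt m : (m < f)%N -> (1 < f)%N -> (q ^ m < Q.-1)%N.
  move=> hm hf; have q1 := q_gt1.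
  have h1 : (q ^ m <= q ^ f.-1)%N by rewrite leq_exp2l //; lia.
  have h2 : Q = (q * q ^ f.-1)%N by rewrite -expnS prednK //; lia.
  have h3 : (1 < q ^ f.-1)%N by rewrite -[1%N](expn0 q) ltn_exp2l //; lia.
  nia.
move=> hi hj /eqP; rewrite (eq_prim_root_expr zP).
have [hf|] := boolP (1 < f)%N; last by have := inertia_gt0; lia.
rewrite !modn_small ?hlt // => /eqP; apply: expnI; exact: q_gt1.
Qed.

(* The coefficients lie in k, so their residues are fixed by the q-power Frobenius. *)
Lemma residue_horner_conj (d : nat) (a : nat -> k) x n :
  (forall i, (i < d)%N -> vge v 0 (a i)) -> vge w 0 x ->
  vge w 1 (\sum_(i < d) (a i)%:A * x ^+ i) ->
  vge w 1 (\sum_(i < d) (a i)%:A * (x ^+ (q ^ n)) ^+ i).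
Proof.
move=> ha hx h0.
elim: n => [|n IH]; first by rewrite expn0 expr1.
rewrite expnSr exprM; set y := x ^+ (q ^ n) in IH *.
have hy : vge w 0 y by apply: vgeX.
have hi (u : E) : vge w 0 u -> forall i : 'I_d, true -> vge w 0 ((a i)%:A * u ^+ i).
  by move=> hu i _; apply: vgeMl; rewrite ?vgeX // vge_alg0 // ha.
have hyq : vge w 0 (y ^+ q) by apply: vgeX.
rewrite -(rmap_eq0 rE) ?rmap_sum //; [|exact: hi|by apply: vge_sum => //; exact: hi].
have -> : \sum_(i < d) rE ((a i)%:A * (y ^+ q) ^+ i) = (\sum_(i < d) rE ((a i)%:A * y ^+ i)) ^+ q.
  rewrite (big_morph (fun x : KE => x ^+ q) (id1 := 0) (op1 := +%R)).
  - apply: eq_bigr => i _; rewrite !rmapM ?vgeX ?vge_alg0 ?ha //.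
    rewrite exprMn !rmapX ?vgeX // -!exprM (mulnC q); congr (_ * _); last by rewrite mulnA.
    have := vge_frobenius hv rk (ha i (ltn_ord i)); rewrite cKk => hq.
    rewrite -rmapX ?vge_alg0 ?ha //; apply/(rmap_eqP rE); rewrite ?vgeX ?vge_alg0 ?ha //.
    have -> : (a i)%:A ^+ q = (a i ^+ q)%:A :> E by rewrite -!in_algE rmorphXn.
    rewrite vge_subC // -scalerBl vge_alg1 //.
    by apply: vgew hq.
  - by move=> u u'; apply: exprDn_pchar; exact: residue_pchar.1.
  - by rewrite expr0n; have := q_gt1; case: (q).
rewrite expf_eq0; apply/andP; split; first by have := q_gt1; lia.
by rewrite -rmap_sum ?(rmap_eq0 rE) //; [apply: vge_sum => //; exact: hi | exact: hi].
Qed.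

Definition zeta_conjs := [seq z ^+ (q ^ i) | i <- iota 0 f].

Lemma zeta_conjs_uniq : uniq zeta_conjs.
Proof.
rewrite map_inj_in_uniq ?iota_uniq // => i j; rewrite !mem_iota => hi hj.
by apply: zeta_conj_inj; lia.
Qed.

Lemma zeta_powers_cong i j : vge w 1 (z ^+ i - z ^+ j) -> z ^+ i = z ^+ j.
Proof. by apply: teichmueller_inj; apply: zetaX_Q. Qed.

(* The f conjugates z ^+ (q ^ i) would all be roots modulo the maximal ideal. *)
Lemma residue_zeta_indep (a : nat -> k) : (forall i, (i < f)%N -> vge v 0 (a i)) ->
  vge w 1 (\sum_(i < f) (a i)%:A * z ^+ i) -> forall i, (i < f)%N -> vge v 1 (a i).
Proof.
move=> ha h i hi; rewrite -vge_alg1 ?ha //.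
apply: (residue_roots wv rE (d := f) (a := fun i => (a i)%:A) (r := zeta_conjs)) => //.
- by move=> j hj; rewrite vge_alg0 // ha.
- by rewrite size_map size_iota.
- exact: zeta_conjs_uniq.
- by move=> _ /mapP[j _ ->]; apply: vgeX => //; apply: zeta_int.
- by move=> _ _ /mapP[j _ ->] /mapP[j' _ ->]; apply: zeta_powers_cong.
move=> _ /mapP[j _ ->]; apply: residue_horner_conj => //; exact: zeta_int.
Qed.

(** Dividing by a coefficient of least valuation makes all coefficients integral and one of them 1,
    so the sum becomes a unit by [residue_zeta_indep]. This yields both the independence of the z ^+
    i with i < f and the absence of ramification in k(z). *)
Lemma zeta_span_val (a : nat -> k) : (exists2 i, (i < f)%N & a i != 0) ->
  \sum_(i < f) (a i)%:A * z ^+ i != 0 /\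
  exists n : int, w (\sum_(i < f) (a i)%:A * z ^+ i) = e%:Z * n.
Proof.
move=> [i0 hi0 ai0].
have [i ai hmin] : exists2 i : 'I_f, a i != 0 & forall j : 'I_f, a j != 0 -> v (a i) <= v (a j).
  by case: (@arg_minP _ _ _ (Ordinal hi0) (fun i : 'I_f => a i != 0) (fun i => v (a i)) ai0) => i; exists i.
pose b j := (a i)^-1 * a j.
have hb j : (j < f)%N -> vge v 0 (b j).
  move=> hj; have [aj0|aj] := eqVneq (a j) 0; first by rewrite /b aj0 mulr0 vge0.
  rewrite vgeE ?mulf_neq0 ?invr_eq0 // vwM ?invr_eq0 // vwV //.
  by have := hmin (Ordinal hj) aj => /=; lia.
have Eab : \sum_(i < f) (a i)%:A * z ^+ i = a i *: \sum_(i < f) (b i)%:A * z ^+ i.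
  rewrite scaler_sumr; apply: eq_bigr => j _.
  by rewrite scalerAl scalerA /b mulrA divff // mul1r.
have S0 : vge w 0 (\sum_(i < f) (b i)%:A * z ^+ i).
  apply: vge_sum => // j _; apply: vgeMl; rewrite ?vge_alg0 ?hb //.
  by apply: vgeX; rewrite // zeta_int.
have S1 : ~~ vge w 1 (\sum_(i < f) (b i)%:A * z ^+ i).
  apply/negP => /residue_zeta_indep h.
  have := h hb i (ltn_ord i); rewrite /b mulVf // vgeE ?oner_eq0 //.
  by rewrite vw1.
have [n0 wS] := vge_unit S0 S1.
rewrite Eab; split; first by rewrite scaler_eq0 negb_or ai.
exists (v (a i)); rewrite -[X in a i *: X]mul1r scalerAl vwM ?scaler_eq0 ?oner_eq0 ?orbF //.
by rewrite wS hw.2 // addr0.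
Qed.

(* By residue_zeta_indep the q ^ f combinations of residues are pairwise incongruent. *)
Lemma zeta_span_cover x : vge w 0 x -> exists a : nat -> k,
  (forall i, vge v 0 (a i)) /\ vge w 1 (x - \sum_(i < f) (a i)%:A * z ^+ i).
Proof.
move=> hx.
have [l hl] : exists l : Kk -> k, forall c, vge v 0 (l c) /\ rk (l c) = c.
  apply: (fin_all_exists (U := fun=> k) (P := fun c l => vge v 0 l /\ rk l = c)) => c.
  by have [y] := rmap_surj rk c; exists y.
pose A (c : {ffun 'I_f -> Kk}) i := if insub i is Some j then l (c j) else 0.
have hA c i : vge v 0 (A c i).
  by rewrite /A; case: insubP => [j _ _|_]; [case: (hl (c j)) | apply: vge0].
have AE c (i : 'I_f) : A c i = l (c i) by rewrite /A valK.
pose S c := \sum_(i < f) (A c i)%:A * z ^+ i.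
have hS c : vge w 0 (S c).
  apply: vge_sum => // j _; apply: vgeMl; rewrite ?vge_alg0 ?hA //.
  by apply: vgeX; rewrite // zeta_int.
have inj : injective (fun c => rE (S c)).
  move=> c d /(rmap_eqP rE (hS c) (hS d)).
  rewrite /S -sumrB (eq_bigr (fun i : 'I_f => (A c i - A d i)%:A * z ^+ i)); last first.
    by move=> i _; rewrite -mulrBl -scalerBl.
  move=> /(residue_zeta_indep (a := fun i => A c i - A d i)) h.
  apply/ffunP => i; rewrite -(hl (c i)).2 -(hl (d i)).2 -!AE.
  by apply/(rmap_eqP rk) => //; apply: h => // j _; apply: vgeB.
have : rE x \in codom (fun c => rE (S c)).
  by apply: inj_card_onto => //; rewrite cKE card_ffun card_ord cKk.
by case/codomP => c hc; exists (A c); split=> [i|]; [apply: hA | apply/(rmap_eqP rE)=> //; apply: hS].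
Qed.

(** * The field k(z): degree, ramification and maximality *)

Local Notation Lz := <<1; z>>%AS.

Lemma kHom_embedding (M : {subfield E}) (s : 'End(E)) : kHom 1 M s ->
  kembedding (fun x : subvs_of M => s (vsval x)).
Proof.
case/kHomP_tmp => s1 sM; split=> [a x y||x y].
- by rewrite linearB linearZ.
- by rewrite rmorph1 s1 // mem1v.
by rewrite rmorphM sM ?subvsP.
Qed.

Lemma vsval_embedding (M : {subfield E}) : kembedding (vsval : subvs_of M -> E).
Proof. by split=> [a x y||x y]; rewrite ?rmorph1 ?rmorphM ?linearB ?linearZ. Qed.

(** On M, both [w] and [w \o s] extend [v] with the same index e, so [vw_unique] identifies them. *)
Lemma kHom_val (M : {subfield E}) (s : 'End(E)) : kHom 1 M s ->
  forall x, x \in M -> x != 0 -> w (s x) = w x.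
Proof.
move=> hs x xM x0; have [B hB] := exists_ext_digits.
have hj := vsval_embedding M; have hs' := kHom_embedding hs.
have [B' hB'] := digits_comp hj hw hB.
have := vw_unique hv kc pi0 vpi e0 (ext_pval_comp hj hw) hB' (ext_pval_comp hs' hw)
  (x := vsproj M x).
rewrite -(kemb_eq0 hj) /= vsprojK // => /(_ x0); have := e0; nia.
Qed.

Lemma zeta_minPoly_roots : exists2 r : seq E,
  minPoly 1 z = \prod_(y <- r) ('X - y%:P) & uniq r /\ {subset r <= [seq z ^+ i | i <- iota 0 Q.-1]}.
Proof.
have : minPoly 1 z %| 'X^(Q.-1) - 1.
  apply: minPoly_dvdp; first by rewrite rpredB ?rpredX ?polyOverX ?rpred1.
  by rewrite rootE !hornerE (prim_expr_order zP) subrr.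
rewrite -(factor_Xn_sub_1 zP) /index_iota subn0 => /dvdp_prod_XsubC[m hm].
exists [seq z ^+ i | i <- mask m (iota 0 Q.-1)].
  rewrite big_map; apply/eqP; rewrite -eqp_monic ?monic_minPoly ?monic_prod_XsubC //.
split; last by move=> _ /mapP[i /mem_mask hi ->]; apply: map_f.
rewrite map_inj_in_uniq ?mask_uniq ?iota_uniq // => i j /mem_mask + /mem_mask.
rewrite !mem_iota => /andP[_ hi] /andP[_ hj] /eqP; rewrite (eq_prim_root_expr zP).
by rewrite !modn_small; [move/eqP | lia | lia].
Qed.

Lemma zeta_degree_ge : (f <= adjoin_degree 1 z)%N.
Proof.
rewrite leqNgt; apply/negP => hlt.
have [a ha] : exists a : nat -> k, forall i, (minPoly 1 z)`_i = (a i)%:A.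
  have h i : exists c, (minPoly 1 z)`_i = c%:A.
    by have /polyOverP/(_ i)/vlineP[c Ec] := minPolyOver 1 z; exists c.
  exists (fun i => proj1_sig (constructive_indefinite_description _ (h i))) => i.
  exact: (proj2_sig (constructive_indefinite_description _ (h i))).
have [|] := zeta_span_val (a := a).
  exists (adjoin_degree 1 z) => //.
  have := monicP (monic_minPoly 1 z); rewrite lead_coefE size_minPoly /= ha => h1.
  by apply: contra_eq_neq h1 => ->; rewrite scale0r eq_sym oner_eq0.
case/negP; apply/eqP; rewrite -[RHS](minPolyxx 1 z).
rewrite (@horner_coef_wide _ f) ?size_minPoly //.
by apply: eq_bigr => i _; rewrite ha.
Qed.

(* zeta_span_cover gives a monic P over k of degree f with P(z) = 0 modulo the maximal ideal.
   Conjugates of z are images of z under valuation-preserving embeddings, so they also are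
   roots of P modulo the maximal ideal, where P has no other roots than the z ^+ (q ^ i). *)
Lemma zeta_minPoly : minPoly 1 z = \prod_(y <- zeta_conjs) ('X - y%:P).
Proof.
have [r Er [ur rz]] := zeta_minPoly_roots.
have [a [ha hza]] := zeta_span_cover (vgeX wv f zeta_int).
pose b (i : nat) : k := if i == f then 1 else - a i.
have hb i : (i < f.+1)%N -> vge v 0 (b i).
  by rewrite /b; case: ifP => _ _; rewrite ?vge1 ?vgeN.
pose P (x : E) : E := \sum_(i < f.+1) (b i)%:A * x ^+ i.
have PE x : P x = x ^+ f - \sum_(i < f) (a i)%:A * x ^+ i.
  rewrite /P big_ord_recr /= /b eqxx scale1r mul1r addrC; congr (_ + _).
  rewrite -sumrN; apply: eq_bigr => i _.
  by rewrite ltn_eqF // scaleNr mulNr.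
have Pz : vge w 1 (P z) by rewrite PE.
have zint i : vge w 0 (z ^+ i) by apply: vgeX; rewrite // zeta_int.
have rroot x : x \in r -> vge w 1 (P x).
  move=> xr; have root_x : root (map_poly \1%VF (minPoly 1 z)) x.
    by rewrite (eq_map_poly (fun u => id_lfunE u)) map_poly_id // Er root_prod_XsubC.
  have hs := kHomExtendP (subvv 1%AS) (kHom1 1 1) root_x.
  have sz := kHomExtend_val (kHom1 1 1) root_x.
  set s := kHomExtend _ _ _ _ in hs sz.
  have zL : z \in Lz by apply: memv_adjoin.
  have PL : P z \in Lz.
    apply: memv_suml => i _; apply: memvM; first by apply: memvZ; apply: mem1v.
    exact: rpredX.
  have -> : P x = s (P z).
    have [s1 sM] := kHomP_tmp hs.
    have sX i : s (z ^+ i) = x ^+ i.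
      elim: i => [|i IH]; first by rewrite !expr0 s1 ?mem1v.
      by rewrite !exprS sM ?IH ?sz // rpredX.
    rewrite /P linear_sum; apply: eq_bigr => i _.
    by rewrite -!scalerAl !mul1r linearZ /= sX.
  have [-> |P0] := eqVneq (P z) 0; first by rewrite linear0 vge0.
  have := kHom_val hs PL P0; move: Pz; rewrite /vge (negPf P0) /= => Pz ->.
  by rewrite Pz orbT.
have croot x : x \in zeta_conjs -> vge w 1 (P x).
  by case/mapP => j _ ->; apply: residue_horner_conj => //; apply: zeta_int.
(* More than f pairwise incongruent roots of P would force its leading coefficient 1 into the
   maximal ideal. *)
have fewroots (t : seq E) : uniq t -> (forall x, x \in t -> vge w 1 (P x)) ->
    {subset t <= [seq z ^+ i | i <- iota 0 Q.-1]} -> (size t <= f)%N.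
  move=> ut rt tz; rewrite leqNgt; apply/negP => ht.
  suff : vge w 1 (b f)%:A.
    by rewrite /b eqxx scale1r vgeE ?oner_eq0 // vw1.
  apply: (residue_roots wv rE (d := f.+1) (a := fun i => (b i)%:A) (r := t)) => //.
  - by move=> i hi; rewrite vge_alg0 // hb.
  - by move=> x /tz/mapP[i _ ->].
  - by move=> x y /tz/mapP[i _ ->] /tz/mapP[j _ ->]; apply: zeta_powers_cong.
have cz : {subset zeta_conjs <= [seq z ^+ i | i <- iota 0 Q.-1]}.
  move=> _ /mapP[i _ ->]; rewrite -(prim_expr_mod zP); apply: map_f.
  by rewrite mem_iota add0n ltn_mod; have := Q_gt1; lia.
have sc : size zeta_conjs = f by rewrite size_map size_iota.
have sub : {subset r <= zeta_conjs}.
  move=> x xr; apply: contraT => xn.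
  have := fewroots (x :: zeta_conjs); rewrite /= xn zeta_conjs_uniq sc ltnn; apply=> //.
    by move=> y; rewrite inE => /orP[/eqP ->|]; [apply: rroot | apply: croot].
  by move=> y; rewrite inE => /orP[/eqP ->|]; [apply: rz | apply: cz].
have sr : size r = adjoin_degree 1 z.
  by have := size_minPoly 1 z; rewrite Er size_prod_XsubC => [[]].
rewrite Er; apply: perm_big; apply: uniq_perm => //; first exact: zeta_conjs_uniq.
have [] // := uniq_min_size ur sub; rewrite sc sr; exact: zeta_degree_ge.
Qed.

Lemma zeta_degree : adjoin_degree 1 z = f.
Proof.
by have := size_minPoly 1 z; rewrite zeta_minPoly size_prod_XsubC size_map size_iota => [[]].
Qed.

Lemma dim_zeta : \dim Lz = f.
Proof. by rewrite dim_Fadjoin zeta_degree dimv1 muln1. Qed.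

Lemma zeta_field_val x : x \in Lz -> x != 0 -> exists n : int, w x = e%:Z * n.
Proof.
move=> /Fadjoin_poly_eq xE x0; set p := Fadjoin_poly 1 z x in xE.
have [a ha] : exists a : nat -> k, forall i, p`_i = (a i)%:A.
  have h i : exists c, p`_i = c%:A.
    by have /polyOverP/(_ i)/vlineP[c Ec] := Fadjoin_polyOver 1 z x; exists c.
  exists (fun i => proj1_sig (constructive_indefinite_description _ (h i))) => i.
  exact: (proj2_sig (constructive_indefinite_description _ (h i))).
have xE' : x = \sum_(i < f) (a i)%:A * z ^+ i.
  have sp : (size p <= f)%N by rewrite -zeta_degree size_Fadjoin_poly.
  rewrite -[LHS]xE (horner_coef_wide z sp).
  by apply: eq_bigr => i _; rewrite ha.
rewrite xE'; apply: (zeta_span_val _).2.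
have [//|hno] := classic (exists2 i, (i < f)%N & a i != 0).
case/negP: x0; rewrite xE' big1 // => i _.
have [->|ai] := eqVneq (a i) 0; first by rewrite scale0r mul0r.
by case: hno; exists i.
Qed.

(** Division of [w] by e is exact on k(z) by [zeta_field_val], and under the quotient pi still has
    valuation 1. *)
Lemma zeta_field_unramified : unramified v (subvs_of Lz).
Proof.
pose u (y : subvs_of Lz) : int := (w (vsval y) %/ e%:Z)%Z.
have enz : e%:Z != 0 by have := e0; lia.
have hj := vsval_embedding Lz.
have uE (y : subvs_of Lz) : y != 0 -> w (vsval y) = e%:Z * u y.
  rewrite -(kemb_eq0 hj) => y0; have [n En] := zeta_field_val (subvsP y) y0.
  by rewrite /u En mulKz.
have nz (y : subvs_of Lz) : y != 0 -> vsval y != 0 by rewrite -(kemb_eq0 hj y).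
have ua a : a != 0 -> u a%:A = 1%:Z * v a.
  by move=> a0; rewrite /u (kemb_alg hj) hw.2 // mulKz // mul1r.
exists u; split=> //; split.
- by exists pi%:A; rewrite ua // vpi scaler_eq0 oner_eq0 orbF.
- move=> x y x0 y0; apply: (mulfI enz); rewrite mulrDr -!uE ?mulf_neq0 // (kembM hj).
  exact: (vwM wv (nz _ x0) (nz _ y0)).
- move=> x y x0 y0 s0; have := wv.2 _ _ (nz _ x0) (nz _ y0).
  rewrite -(kembD hj) => /(_ (nz _ s0)); rewrite !ge_min !uE //.
  by rewrite !ler_pM2l //; have := e0; lia.
Qed.

Lemma residue_teichmueller x : vge w 0 x ->
  exists2 t, vge w 1 (x - t) & t = 0 \/ exists i : nat, t = z ^+ i.
Proof.
move=> hx; have [B hB] := exists_ext_digits.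
have [t tQ tx] := teichmueller hv kc pi0 vpi e0 hw hB vge_Q1 vge_Q0 hx.
exists t; first by rewrite vge_subC.
have [->|t0] := eqVneq t 0; [by left | right].
have : t ^+ Q.-1 = 1.
  by apply: (mulfI t0); rewrite mulr1 -exprS prednK // -ltnS ltnW // ltnS Q_gt1.
by move/(prim_rootP zP) => [i ->]; exists i.
Qed.

(* M is complete, hence contains Teichmueller representatives of its residues, and these
   are digits modulo pi since w takes its values on M in e Z. *)
Lemma unramified_sub_zeta (M : fieldExtType k) (j : M -> E) :
  kembedding j -> unramified v M -> forall x, j x \in Lz.
Proof.
move=> hj [wM [dM hwM]].
have [B hB] := exists_ext_digits; have [B' hB'] := digits_comp hj hw hB.
have hwj := ext_pval_comp hj hw.
have wE x : x != 0 -> w (j x) = e%:Z * wM x.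
  move=> x0; have := vw_unique hv kc pi0 vpi e0 hwj hB' (conj (dval_val dM) hwM) x0.
  by move=> /= ->; rewrite mul1r.
have ge_e x : vge w 1 (j x) -> vge w e%:Z (j x).
  rewrite /vge (kemb_eq0 hj); have [//|x0 /=] := eqVneq x 0.
  rewrite wE //; move: (wM x) => n; have := e0 => e1 h.
  have n1 : 1 <= n by move: e1 h; clear; nia.
  by move: e1 n1; clear; nia.
pose T := 0 :: [seq z ^+ i | i <- iota 0 Q.-1].
have TP t : (t \in T) = (t ^+ Q == t).
  apply/idP/eqP; first rewrite inE => /orP[/eqP ->|/mapP[i _ ->]].
  - by rewrite expr0n; have := Q_gt1; case: Q.
  - exact: zetaX_Q.
  move=> tQ; rewrite inE; have [//|t0 /=] := eqVneq t 0.
  have : t ^+ Q.-1 = 1 by apply: (mulfI t0); rewrite mulr1 -exprS prednK // ltnW // Q_gt1.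
  by move/(prim_rootP zP) => [i ->]; apply: map_f; rewrite mem_iota /= add0n.
have [r hr] : exists r : seq M, forall x, (x \in r) = (j x \in T).
  elim: (T) => [|t T' [r IH]]; first by exists [::].
  have [[x jx]|hno] := classic (exists x, j x = t).
    exists (x :: r) => y; rewrite !inE IH -jx; congr (_ || _).
    by apply/eqP/eqP => [->|/(kemb_inj hj)].
  exists r => y; rewrite inE IH; case: eqP => // jy.
  by case: hno; exists y.
have dr : digits (w \o j) e r.
  split=> [b|x].
    rewrite hr (vge_comp hj) inE => /orP[/eqP ->|/mapP[i _ ->]]; first exact: vge0.
    by apply: vgeX => //; apply: zeta_int.
  move=> hx.
  have h1 y : vge (w \o j) 0 y -> vge (w \o j) 1 (y ^+ Q - y).
    by rewrite !(vge_comp hj) (kembB hj) (kembX hj); apply: vge_Q1.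
  have h0 : vge (w \o j) 1 Q%:R.
    rewrite (vge_comp hj) (_ : j Q%:R = Q%:R) ?vge_Q0 //.
    by rewrite -(scaler_nat Q (1 : M)) -scaler_nat -[Q%:R *: 1]/(Q%:R%:A) (kemb_alg hj).
  have [t tQ tx] := teichmueller hv kc pi0 vpi e0 hwj hB' h1 h0 hx.
  exists t; first by rewrite hr TP -(kembX hj) tQ.
  by move: tx; rewrite !(vge_comp hj) => /ge_e; rewrite !(kembB hj) vge_subC.
have int x : vge (w \o j) 0 x -> j x \in Lz.
  move/(digits_span hv kc pi0 vpi e0 hwj dr) => [c [_ ->]].
  rewrite (big_morph j (kembD hj) (kemb0 hj)); apply: memv_suml => i _.
  rewrite (kembZ hj); apply: memvZ.
  have : r`_i \in r by apply: mem_nth.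
  rewrite hr inE => /orP[/eqP ->|/mapP[n _ ->]]; first exact: mem0v.
  by apply: rpredX; apply: memv_adjoin.
move=> x; have [->|x0] := eqVneq x 0; first by rewrite (kemb0 hj) mem0v.
have pn0 : pi ^+ `|wM x| != 0 by rewrite expf_neq0.
rewrite -[x]scale1r -(mulVf pn0) -scalerA (kembZ hj); apply: memvZ; apply: int.
rewrite (vge_comp hj) (kembZ hj) -[j x]mul1r scalerAl vgeE; last first.
  by rewrite mulf_neq0 ?(kemb_eq0 hj) // scaler_eq0 oner_eq0 orbF.
rewrite vwM ?(kemb_eq0 hj) ?scaler_eq0 ?oner_eq0 ?orbF // hw.2 // vwX // vpi wE //.
by have := e0; nia.
Qed.

Lemma max_unramE (Eur : {subfield E}) : max_unram v Eur -> Eur = Lz.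
Proof.
move=> [h1 h2]; apply/val_inj/eqP; rewrite eqEsubv h2 ?andbT; last exact: zeta_field_unramified.
apply/subvP => x xE; have := unramified_sub_zeta (vsval_embedding Eur) h1 (vsproj Eur x).
by rewrite vsprojK.
Qed.

(* The powers pE ^+ i, i < e, span E over k(z) by digit expansion; they are free because w
   takes its values on k(z) in e Z. *)
Lemma dim_ext : \dim {:E} = (e * f)%N.
Proof.
pose W := (\sum_(i < e) Lz * <[pE ^+ i]>)%VS.
have W_full x : x \in W.
  pose s := 0 :: [seq z ^+ i | i <- iota 0 Q.-1].
  have sL y : y \in s -> y \in Lz.
    rewrite inE => /orP[/eqP ->|/mapP[n _ ->]]; first exact: mem0v.
    by apply: rpredX; apply: memv_adjoin.
  have [||B hB BW] := @exists_digits _ _ w pE s e wv pE0 wpE.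
  - move=> y; rewrite inE => /orP[/eqP ->|/mapP[n _ ->]]; first exact: vge0.
    by apply: vgeX => //; apply: zeta_int.
  - move=> y /residue_teichmueller[t ht tz]; exists t => //; rewrite inE.
    case: tz => [->|[i ->]]; first by rewrite eqxx.
    rewrite -(prim_expr_mod zP) map_f ?orbT // mem_iota /= add0n ltn_mod.
    by have := Q_gt1; lia.
  have int y : vge w 0 y -> y \in W.
    move/(digits_span hv kc pi0 vpi e0 hw hB) => [c [_ ->]].
    apply: memv_suml => i _; apply: memvZ.
    have [d ds ->] := BW _ (mem_nth 0 (ltn_ord i)).
    apply: memv_sumr => n _; apply: memv_mul; last exact: memv_line.
    exact: sL.
  have [->|x0] := eqVneq x 0; first exact: mem0v.
  have pn0 : pi ^+ `|w x| != 0 by rewrite expf_neq0.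
  rewrite -[x]scale1r -(mulVf pn0) -scalerA; apply: memvZ; apply: int.
  rewrite -[x in _ *: x]mul1r scalerAl vgeE; last by rewrite mulf_neq0 // scaler_eq0 oner_eq0 orbF.
  rewrite vwM ?scaler_eq0 ?oner_eq0 ?orbF // hw.2 // vwX // vpi.
  by have := e0; nia.
have le : (\dim {:E} <= e * f)%N.
  apply: (@leq_trans (\dim W)); first by apply/dimvS/subvP => x _.
  apply: (leq_trans (dimv_leq_sum _ _ _)).
  rewrite (eq_bigr (fun=> f)) ?sum_nat_const ?card_ord // => i _.
  by rewrite dim_cosetv ?expf_neq0 // dim_zeta.
have full : <<Lz; pE>>%VS = fullv.
  apply/eqP; rewrite eqEsubv subvf; apply/subvP => x _.
  have := W_full x; apply/subvP; apply/subv_sumP => i _.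
  apply: prodv_sub; first exact: subv_adjoin.
  by rewrite -memvE rpredX // memv_adjoin.
have ge : (e <= adjoin_degree Lz pE)%N.
  rewrite leqNgt; apply/negP => hlt.
  pose p := minPoly Lz pE; pose a i := p`_i * pE ^+ i.
  have wa i : a i != 0 -> exists n : int, w (a i) = e%:Z * n + i%:Z.
    rewrite mulf_eq0 expf_eq0 (negPf pE0) andbF orbF => pi_0.
    have /polyOverP/(_ i) pL := minPolyOver Lz pE.
    have [n En] := zeta_field_val pL pi_0.
    by exists n; rewrite /a vwM ?expf_neq0 // vwX // wpE mulr1 -En.
  have sp : size p = (adjoin_degree Lz pE).+1 by apply: size_minPoly.
  have [||] := @val_sum_distinct _ _ wv (size p) a.
  - exists (size p).-1; first by rewrite sp.
    by rewrite /a -lead_coefE (monicP (monic_minPoly _ _)) mul1r expf_neq0.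
  - rewrite sp => i j hi hj /wa[n ->] /wa[m ->] h.
    have : n = m by nia.
    by move=> nm; move: h; rewrite nm; lia.
  by rewrite /a -horner_coef minPolyxx eqxx.
apply/eqP; rewrite eqn_leq le /= -full dim_Fadjoin dim_zeta.
by rewrite leq_mul2r ge orbT.
Qed.

(** * Automorphisms of E and lifts of Frobenius *)

Lemma autk_val g x : autk g -> x != 0 -> w (g x) = w x.
Proof. by rewrite /autk kAutfE => hg; apply: (kHom_val hg); apply: memvf. Qed.

Lemma autk_vge g N x : autk g -> vge w N x -> vge w N (g x).
Proof.
move=> hg; have [->|x0] := eqVneq x 0; first by rewrite linear0.
by rewrite /vge (negPf x0) /= => h; rewrite (autk_val hg x0) h orbT.
Qed.

Lemma autk_zeta g : autk g -> exists2 i, (i < f)%N & g z = z ^+ (q ^ i).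
Proof.
rewrite /autk kAutfE => hg.
have := kHom_root_id (subvf _) hg (minPolyOver 1 z) (memvf z) (root_minPoly 1 z).
by rewrite zeta_minPoly root_prod_XsubC => /mapP[i]; rewrite mem_iota => hi ->; exists i.
Qed.

(** If tau lifts Frobenius, then tau z and z ^+ q are congruent and both fixed by the Q-th power,
    hence equal. Conversely, every integral x is congruent to 0 or to a power of z, where the
    Frobenius congruence is evident. *)
Lemma strong_extP : strong_ext w q Lz <-> exists2 tau, autk tau & tau z = z ^+ q.
Proof.
split=> [[tau [h1 h2 h3]]|[tau h1 tz]].
  exists tau => //; apply: teichmueller_inj; rewrite -?autkX ?zetaQ ?zetaX_Q //.
  by apply/vcongP/h3; [apply: memv_adjoin | apply/vintP/zeta_int].
have h1' : kHom 1 {:E} tau by move: h1; rewrite /autk kAutfE.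
exists tau; split=> //.
  rewrite kAutE (kHomSr (subvf _) h1'); apply/subvP => _ /memv_imgP[x xL ->].
  have [p p1 ->] := Fadjoin_polyP xL.
  rewrite (kHom_horner h1') ?memvf ?(polyOverSv (subvf _) p1) // (kHom_poly_id h1') //.
  rewrite tz; have /Fadjoin_polyP : z ^+ q \in Lz by rewrite rpredX // memv_adjoin.
  case=> r r1 ->; rewrite -horner_comp; apply: mempx_Fadjoin.
  exact: polyOver_comp.
move=> x xL /vintP hx; apply/vcongP; have [t xt tz'] := residue_teichmueller hx.
have tt : tau t = t ^+ q.
  case: tz' => [->|[i ->]]; last by rewrite autkX // tz -!exprM mulnC.
  by rewrite linear0 expr0n; have := q_gt1; case: (q).
apply: (vge_sub_trans wv (y := tau t)); first by rewrite -linearB; apply: autk_vge.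
rewrite tt vge_subC //; apply: vge_subX => //.
by rewrite (vge_subr wv (x := x)) //; apply: vgew xt.
Qed.

Lemma zeta_expq_mod i : z ^+ (q ^ (i %% f)) = z ^+ (q ^ i).
Proof.
rewrite {2}(divn_eq i f); elim: (i %/ f)%N => [|n IH]; first by rewrite mul0n.
by rewrite mulSn -addnA expnD exprM zetaQ.
Qed.

Lemma zeta_frobenius_root : root (minPoly 1 z) (z ^+ q).
Proof.
rewrite zeta_minPoly root_prod_XsubC -{1}(expn1 q) -zeta_expq_mod.
by apply: map_f; rewrite mem_iota /= add0n ltn_mod; exact: inertia_gt0.
Qed.

Lemma disjoint_frobenius (E' : {subfield E}) :
  \dim E' = e -> (E' * Lz)%VS = fullv ->
  exists tau, [/\ autk tau, {in E', forall x, tau x = x} & tau z = z ^+ q].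
Proof.
move=> dE' full.
have full' : <<E'; z>>%VS = fullv.
  apply/eqP; rewrite eqEsubv subvf -full; apply: prodv_sub; first exact: subv_adjoin.
  by rewrite sub_adjoin1v memv_adjoin.
have deg : adjoin_degree E' z = f.
  have := dim_Fadjoin E' z; rewrite full' dim_ext dE' mulnC => /eqP.
  by rewrite eqn_pmul2r // => /eqP.
have Em : minPoly E' z = minPoly 1 z.
  apply/eqP; rewrite -eqp_monic ?monic_minPoly //.
  by rewrite -dvdp_size_eqp ?minPolyS ?sub1v // !size_minPoly deg zeta_degree.
have rz : root (map_poly \1%VF (minPoly E' z)) (z ^+ q).
  by rewrite (eq_map_poly (fun u => id_lfunE u)) map_poly_id // Em zeta_frobenius_root.
have hk := kHomExtendP (subvv E') (kHom1 E' E') rz; rewrite full' in hk.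
exists (kHomExtend E' \1 z (z ^+ q)); split.
- by rewrite /autk kAutfE; apply: kHomSl hk; apply: sub1v.
- by move=> x xE; rewrite kHomExtend_id // lfunE.
- exact: (kHomExtend_val (kHom1 E' E') rz).
Qed.

(** E is a splitting field over k(z) of the product of the minimal polynomials of a k-basis, so the
    embedding z |-> z ^+ q of k(z) extends to E. *)
Lemma normal_frobenius : normal_ext E -> exists2 tau, autk tau & tau z = z ^+ q.
Proof.
move=> nE.
have rz : root (map_poly \1%VF (minPoly 1 z)) (z ^+ q).
  by rewrite (eq_map_poly (fun u => id_lfunE u)) map_poly_id // zeta_frobenius_root.
have hk := kHomExtendP (subvv 1%AS) (kHom1 1 1) rz.
have gen (B : seq E) : exists (p : {poly E}) (rs : seq E), [/\ p \is a polyOver 1%VS,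
    p = \prod_(y <- rs) ('X - y%:P) & {subset B <= rs}].
  elim: B => [|b B [p [rs [p1 Ep rsB]]]].
    by exists 1, [::]; rewrite big_nil rpred1.
  have [r Er] := nE b.
  exists (minPoly 1 b * p), (r ++ rs); split.
  - by rewrite rpredM ?minPolyOver.
  - by rewrite big_cat /= Er Ep.
  move=> x; rewrite inE mem_cat => /orP[/eqP ->|/rsB ->]; last by rewrite orbT.
  by rewrite -root_prod_XsubC -Er root_minPoly.
have [p [rs [p1 Ep rsB]]] := gen (vbasis {:E}).
have sp : splittingFieldFor Lz p fullv.
  exists rs; first by rewrite Ep eqpxx.
  apply/eqP; rewrite eqEsubv subvf /= -(span_basis (vbasisP fullv)).
  by apply/span_subvP => x /rsB xrs; apply: seqv_sub_adjoin.
have [tau ht htz] := kHom_extends (sub1v Lz) hk p1 sp.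
exists tau; first by rewrite autk_kHom.
by rewrite -htz ?memv_adjoin // (kHomExtend_val (kHom1 1 1) rz).
Qed.

(** * Tensor decompositions and subfields of degree e *)

Lemma lfun_embedding (K : fieldExtType k) (i : 'Hom(K, E)) :
  i 1 = 1 -> (forall x y, i (x * y) = i x * i y) -> kembedding i.
Proof. by move=> i1 iM; split=> // a x y; rewrite linearB linearZ. Qed.

Lemma limg_is_aspace (K : fieldExtType k) (i : 'Hom(K, E)) :
  kembedding i -> is_aspace (limg i).
Proof.
move=> hi; apply/andP; split.
  by apply: has_algid1; rewrite -(kemb1 hi) memv_img ?memvf.
apply/prodvP => _ _ /memv_imgP[x _ ->] /memv_imgP[y _ ->].
by rewrite -(kembM hi) memv_img ?memvf.
Qed.

Lemma dim_limg (K : fieldExtType k) (i : 'Hom(K, E)) :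
  kembedding i -> \dim (limg i) = \dim {:K}.
Proof.
move=> hi; apply: limg_dim_eq; apply/eqP; rewrite -subv0; apply/subvP => x.
by rewrite memv_cap memv_ker memv0 (kemb_eq0 hi) => /andP[].
Qed.

(** Comparing valuations on a uniformizer of K shows that [K : k] divides e, while U embeds into
    k(z). As the two degrees multiply to e f, both bounds are attained. *)
Lemma tensor_decomp_subfield : tensor_decomp v E ->
  exists2 E' : {subfield E}, \dim E' = e & (E' * Lz)%VS = fullv.
Proof.
case=> K [U [[wK [dK hwK]] uU [iK [iU [iK1 iKM iU1 iUM hb]]]]].
have hK := lfun_embedding iK1 iKM; have hU := lfun_embedding iU1 iUM.
have dimK : (\dim {:K} <= e)%N.
  have [B hB] := exists_ext_digits; have [B' hB'] := digits_comp hK hw hB.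
  have [[p [p0 wp]] _ _] := dK.
  have := vw_unique hv kc pi0 vpi e0 (ext_pval_comp hK hw) hB' (conj (dval_val dK) hwK) p0.
  rewrite wp mulr1 /=; have := e0; move: (w (iK p)) (\dim {:K}) => n d; clear => e1 h.
  have n1 : 1 <= n by nia.
  by nia.
have UL : (limg iU <= Lz)%VS.
  by apply/subvP => _ /memv_imgP[x _ ->]; apply: unramified_sub_zeta.
have dimU : (\dim {:U} <= f)%N by rewrite -(dim_limg hU) -dim_zeta dimvS.
have [/eqP sb fb] := andP hb.
have := eqP fb; rewrite sb size_allpairs !size_tuple dim_ext => dEKU.
have f0 := inertia_gt0.
have eK : \dim {:K} = e.
  apply/eqP; rewrite eqn_leq dimK /= -(leq_pmul2r f0) dEKU.
  by rewrite leq_mul2l dimU orbT.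
exists (ASpace (limg_is_aspace hK)); first by rewrite /= dim_limg.
apply/eqP; rewrite eqEsubv subvf /= -sb; apply/span_subvP => _ /allpairsP[[x y] /= [_ _ ->]].
apply: memv_mul; first by rewrite memv_img ?memvf.
by apply: (subvP UL); rewrite memv_img ?memvf.
Qed.

(** The degree of the compositum is divisible by e and by f, hence by e f. *)
Lemma coprime_disjoint (E' : {subfield E}) : coprime e f -> \dim E' = e ->
  (E' * Lz)%VS = fullv.
Proof.
move=> cef dE'; apply/eqP; rewrite eqEdim subvf /= dim_ext.
have d1 : (e %| \dim (E' * Lz))%N.
  by rewrite -dE'; apply: (field_dimS (E := (E' * Lz)%AS)); apply: field_subvMr.
have d2 : (f %| \dim (E' * Lz))%N.
  by rewrite -dim_zeta; apply: (field_dimS (E := (E' * Lz)%AS)); apply: field_subvMl.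
apply: dvdn_leq; last by rewrite Gauss_dvd // d1.
by apply: (adim_gt0 (E' * Lz)%AS).
Qed.

Lemma autk_exp_zeta tau n : autk tau -> tau z = z ^+ q -> (tau ^+ n) z = z ^+ (q ^ n).
Proof.
move=> at_ tz; elim: n => [|n IH]; first by rewrite expr0 id_lfunE expn0 expr1.
by rewrite lexpS IH autkX // tz -exprM expnS.
Qed.

(* The norm of a uniformizer of E lies in E' and has valuation f, while pi has valuation e:
   as e and f are coprime, E' contains an element of valuation 1. *)
Lemma disjoint_totally_ramified (E' : {subfield E}) : coprime e f ->
  \dim E' = e -> totally_ramified v (subvs_of E').
Proof.
move=> cef dE'; have full := coprime_disjoint cef dE'.
have [tau [at_ tE' tz]] := disjoint_frobenius dE' full.
have full' : <<E'; z>>%VS = fullv.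
  apply/eqP; rewrite eqEsubv subvf -full; apply: prodv_sub; first exact: subv_adjoin.
  by rewrite sub_adjoin1v memv_adjoin.
have tXE' n : {in E', tau ^+ n =1 id}.
  by move=> x xE; elim: n => [|n IH]; rewrite ?id_lfunE // lexpS IH tE'.
have tf : tau ^+ f = 1.
  apply: (autk_fix_adjoin (autk_exp _ at_) (autk1 E) (tXE' f) _ full').
    by move=> x _; rewrite id_lfunE.
  by rewrite autk_exp_zeta // zetaQ id_lfunE.
have f0 := inertia_gt0.
have prim : f.-primitive_root tau.
  have [m hm mf] := prim_order_exists f0 tf.
  suff -> : f = m by [].
  apply/eqP; rewrite eqn_leq (dvdn_leq f0 mf) andbT leqNgt; apply/negP => mltf.
  have := autk_exp_zeta m at_ tz; rewrite (prim_expr_order hm) id_lfunE => zm.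
  have m0 : m = 0%N by apply: zeta_conj_inj => //; rewrite -zm expn0 expr1.
  by have := prim_order_gt0 hm; rewrite m0.
have [F hF dF] := cyclic_fixed_field at_ prim.
(* F contains E' and has the same degree e, so elements fixed by tau, such as the norm N below, lie
   in E'. *)
have FE' : (F <= E')%VS.
  rewrite -(geq_leqif (dimv_leqif_sup _)); last by apply/subvP => x xE; apply/hF/tE'.
  by move: dF; rewrite dim_ext mulnC dE' => /eqP; rewrite eqn_pmul2l // => /eqP ->.
pose N := \prod_(i < f) (tau ^+ i) pE.
have tauN0 n : (tau ^+ n) pE != 0.
  apply: contraNneq pE0 => h; apply/eqP/(autk_inj (autk_exp n at_)).
  by rewrite h linear0.
have NE' : N \in E'.
  apply: (subvP FE'); apply/hF; have [G GE] := autk_rmorphism at_.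
  rewrite -GE rmorph_prod /N -(prednK f0) big_ord_recr big_ord_recl /= mulrC.
  rewrite GE -lexpS (prednK f0) tf; congr (_ * _).
  by apply: eq_bigr => i _; rewrite GE -lexpS.
have N0 : N != 0 by apply/prodf_neq0 => i _; apply: tauN0.
have wN : w N = f%:Z.
  have -> : forall n, w (\prod_(i < n) (tau ^+ i) pE) = n%:Z.
    elim=> [|n IH]; first by rewrite big_ord0 vw1.
    rewrite big_ord_recr /= vwM //; last by apply/prodf_neq0 => i _; apply: tauN0.
    by rewrite IH (autk_val (autk_exp n at_) pE0) wpE; lia.
  by [].
have [a [b ab]] : exists a b : int, a * e%:Z + b * f%:Z = 1.
  have := Bezoutz e%:Z f%:Z => [[a [b ab]]]; exists a, b; rewrite ab.
  by move: cef; rewrite /coprime /gcdz /= => /eqP ->.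
have dE'' : \dim {:subvs_of E'} = e by rewrite dimvf.
have hj := vsval_embedding E'; have [[vM vD] va] := ext_pval_comp hj hw.
rewrite /totally_ramified dE''; exists (w \o vsval); split=> //; split=> //.
have piA0 : pi%:A != 0 :> E by rewrite scaler_eq0 oner_eq0 orbF.
have yE' : pi%:A ^ a * N ^ b \in E'.
  have expzE x n : x \in E' -> x ^ n \in E'.
    by move=> xE; case: n => n; rewrite /exprz ?rpredV rpredX.
  by rewrite rpredM ?expzE // memvZ // mem1v.
exists (vsproj E' (pi%:A ^ a * N ^ b)).
rewrite -(kemb_eq0 hj) /= vsprojK // mulf_neq0 ?expfz_neq0 //; split=> //.
by rewrite vwM ?expfz_neq0 // !vwXz // hw.2 // vpi wN mulr1.
Qed.

(** The products of basis vectors span because the compositum is E; there are e f of them, so they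
    form a basis. *)
Lemma subfield_tensor_decomp (E' : {subfield E}) : coprime e f -> \dim E' = e ->
  tensor_decomp v E.
Proof.
move=> cef dE'; exists (subvs_of E'), (subvs_of Lz); split.
- exact: disjoint_totally_ramified.
- exact: zeta_field_unramified.
exists (linfun vsval), (linfun vsval).
have vs1 (M : {subfield E}) : linfun (vsval : subvs_of M -> E) 1 = 1.
  by rewrite lfunE; exact: (kemb1 (vsval_embedding M)).
have vsM (M : {subfield E}) x y : linfun (vsval : subvs_of M -> E) (x * y) =
    linfun (vsval : subvs_of M -> E) x * linfun (vsval : subvs_of M -> E) y.
  by rewrite !lfunE; exact: (kembM (vsval_embedding M)).
split; [exact: vs1 | exact: vsM | exact: vs1 | exact: vsM |].
have dimS (M : {subfield E}) : \dim {:subvs_of M} = \dim M by rewrite dimvf.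
set X := (X in basis_of _ X); suff sX : (fullv <= <<X>>)%VS.
  have EX : <<X>>%VS = fullv by apply/eqP; rewrite eqEsubv subvf.
  rewrite /basis_of EX eqxx /free EX /X size_allpairs !size_tuple !dimS.
  by rewrite dE' dim_zeta dim_ext eqxx.
rewrite -(coprime_disjoint cef dE'); apply/prodvP => x y xE yL.
have xs (M : {subfield E}) u : u \in M -> u = \sum_i coord (vbasis {:subvs_of M}) i (vsproj M u) *:
    vsval (vbasis {:subvs_of M})`_i.
  move=> uM; rewrite -{1}(vsprojK uM) {1}(coord_vbasis (memvf (vsproj M u))) linear_sum.
  by apply: eq_bigr => i _; rewrite linearZ.
rewrite (xs _ _ xE) (xs _ _ yL) mulr_suml memv_suml // => i _.
rewrite mulr_sumr memv_suml // => j _.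
rewrite -scalerAl -scalerAr !memvZ //; apply: memv_span; apply/allpairsP.
exists ((vbasis {:subvs_of E'})`_i, (vbasis {:subvs_of Lz})`_j) => /=.
by split; rewrite ?lfunE // mem_nth // size_tuple.
Qed.

(** * The structure of Aut(E|k) *)

Lemma autMP g : reflect (autk g /\ g z = z) (autM Lz g).
Proof.
rewrite /autM kAutfE autk_kHom; apply: (iffP idP) => [h|[h1 gz]].
  split; first by apply: kHomSl h; apply: sub1v.
  by have [+ _] := kHomP_tmp h; apply; apply: memv_adjoin.
have [_ hM] := kHomP_tmp h1; apply/kHomP_tmp; split=> // x /Fadjoin_polyP[p p1 ->].
by rewrite (kHom_horner h1) ?memvf ?(polyOverSv (subvf _) p1) // (kHom_poly_id h1) // gz.
Qed.

Lemma fixed_degree_dvd n (F : {subfield E}) : (Lz <= F)%VS ->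
  \dim {:E} = (n * \dim F)%N -> (n %| e)%N.
Proof.
move=> /field_dimS; rewrite dim_zeta => /dvdnP[m ->].
rewrite dim_ext mulnA => /eqP; rewrite eqn_pmul2r ?inertia_gt0 // => /eqP ->.
exact: dvdn_mulr.
Qed.

Lemma zeta_fixed g x : autk g -> g z = z -> x \in Lz -> g x = x.
Proof.
move=> ag gz; have : autM Lz g by apply/autMP.
by rewrite /autM kAutfE => /kHomP_tmp[+ _]; apply.
Qed.

(* tau ^+ f fixes k(z), so its order m divides e by Artin's theorem and is prime to f: a power
   tau ^+ a with a = 0 mod m and a = 1 mod f does the job. *)
Lemma frobenius_split : coprime e f -> (exists2 tau, autk tau & tau z = z ^+ q) ->
  exists s, [/\ autk s, s z = z ^+ q & s ^+ f = 1].
Proof.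
move=> cef [tau at_ tz]; pose nu := tau ^+ f.
have an : autk nu by apply: autk_exp.
have nz : nu z = z by rewrite /nu autk_exp_zeta // zetaQ.
have [m hm] := autk_order an.
have [F hF dF] := cyclic_fixed_field an hm.
have me : (m %| e)%N.
  apply: (fixed_degree_dvd _ dF); apply/subvP => x xL; apply/hF; exact: zeta_fixed.
have cmf : coprime m f by apply: coprime_dvdl cef.
pose a := chinese m f 0 1.
exists (tau ^+ a); split.
- exact: autk_exp.
- rewrite autk_exp_zeta // -zeta_expq_mod (chinese_modr cmf 0 1) zeta_expq_mod.
  by rewrite expn1.
rewrite -exprM mulnC exprM -/nu; apply/eqP; rewrite -(prim_order_dvd hm).
by apply/eqP; rewrite (chinese_modl cmf 0 1) mod0n.
Qed.

(** Restriction to k(z) has image [sI], recorded by the exponents i for which z |-> z ^+ (q ^ i)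
    lifts to E, and kernel [sN], the group Aut(E|k(z)); the order of the kernel divides e by Artin's
    theorem. *)
Lemma card_aut_factor n : card_aut E n -> exists (sI : seq nat) (sN : seq 'End(E)),
  [/\ n = (size sI * size sN)%N, (size sN %| e)%N, uniq sI,
      forall i, i \in sI -> (i < f)%N
    & forall i, i \in sI <-> (i < f)%N /\ exists2 g, autk g & g z = z ^+ (q ^ i)].
Proof.
move=> [sG [uG <- hG]].
pose sN := [seq g : 'End(E) <- sG | g z == z].
pose P (i : nat) (g : 'End(E)) := g z == z ^+ (q ^ i).
pose sI := [seq i <- iota 0 f | has (P i) sG].
(* A choice of lift for each exponent: every automorphism is uniquely [rep i] composed with an
   element of the kernel. *)
pose rep i : 'End(E) := nth \1%VF sG (find (P i) sG).
have repP i : i \in sI -> autk (rep i) /\ rep i z = z ^+ (q ^ i).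
  rewrite mem_filter => /andP[hi _]; split; last by apply/eqP; apply: (nth_find _ hi).
  by rewrite -hG mem_nth // -has_find.
have NP g : (g \in sN) = autk g && (g z == z) by rewrite mem_filter hG andbC.
have IP i : i \in sI <-> (i < f)%N /\ exists2 g, autk g & g z = z ^+ (q ^ i).
  rewrite mem_filter mem_iota /= add0n; split.
    by case/andP=> /hasP[g gG /eqP gz] ->; split=> //; exists g; rewrite -?hG.
  by case=> -> [g ag gz]; rewrite andbT; apply/hasP; exists g; rewrite ?hG // /P gz.
have Nz g i : g \in sN -> g (z ^+ i) = z ^+ i.
  by rewrite NP => /andP[ag /eqP gz]; rewrite autkX // gz.
exists sI, sN; split=> //; last first.
- by move=> i /IP[].
- by rewrite filter_uniq // iota_uniq.
- have aN g : g \in sN -> autk g by rewrite NP => /andP[].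
  have [F hF] := exists_fixed_field aN.
  apply: (fixed_degree_dvd (F := F)).
    apply/subvP => x xL; apply/hF => g; rewrite NP => /andP[ag /eqP gz].
    exact: zeta_fixed.
  apply: artin_dim hF => //; first by rewrite filter_uniq.
  + by rewrite NP autk1 id_lfunE eqxx.
  move=> g h; rewrite !NP => /andP[ag /eqP gz] /andP[ah /eqP hz].
  by rewrite autk_comp // comp_lfunE hz gz eqxx.
have -> : (size sI * size sN)%N = size [seq (rep i \o h)%VF | i <- sI, h <- sN].
  by rewrite size_allpairs.
have repz i h : i \in sI -> h \in sN -> (rep i \o h)%VF z = z ^+ (q ^ i).
  by move=> iI; rewrite NP => /andP[_ /eqP hz]; rewrite comp_lfunE hz; case: (repP i iI).
apply: perm_size; apply: uniq_perm => //.
  apply: allpairs_uniq; rewrite ?filter_uniq ?iota_uniq //.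
  move=> _ _ /allpairsP[[i h] /= [iI hN ->]] /allpairsP[[i' h'] /= [iI' hN' ->]] Eih.
  have ii' : i = i'.
    apply: zeta_conj_inj; [by case: (proj1 (IP i) iI) | by case: (proj1 (IP i') iI') |].
    by rewrite -(repz i h) // -(repz i' h') // Eih.
  subst i'; congr (_, _); apply/lfunP => x; apply: (autk_inj (repP i iI).1).
  by have := congr1 (fun u : 'End(E) => u x) Eih; rewrite !comp_lfunE.
move=> g; apply/idP/allpairsP => [|[[i h] /= [iI hN ->]]]; rewrite hG; last first.
  by apply: autk_comp; [case: (repP i iI) | move: hN; rewrite NP => /andP[]].
move=> ag; have [i fi gz] := autk_zeta ag.
have iI : i \in sI by apply/IP; split=> //; exists g.
have [ar rz] := repP i iI.
exists (i, ((rep i)^-1 \o g)%VF); split=> //=.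
  rewrite NP autk_comp ?autk_inv //= comp_lfunE gz -rz.
  by rewrite autkK.
by apply/lfunP => x; rewrite !comp_lfunE autkVK.
Qed.

Lemma frobenius_card_aut : (exists2 tau, autk tau & tau z = z ^+ q) ->
  exists2 n, card_aut E n & (f %| n)%N.
Proof.
move=> [tau at_ tz]; have [n hn] := exists_card_aut E; exists n => //.
have [sI [sN [-> _ uI If IP]]] := card_aut_factor hn.
apply: dvdn_mulr; rewrite -[f](size_iota 0) (_ : size sI = size (iota 0 f)) //.
apply/perm_size/uniq_perm; rewrite ?iota_uniq // => i; rewrite mem_iota /= add0n.
apply/idP/idP => [/If//|fi]; apply/IP; split=> //.
by exists (tau ^+ i); [apply: autk_exp | apply: autk_exp_zeta].
Qed.

(** The kernel has order prime to f, so f divides the size of the image. The image is nonempty and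
    has at most f elements, hence contains every exponent, that of Frobenius included. *)
Lemma card_aut_frobenius n : coprime e f -> card_aut E n -> (f %| n)%N ->
  exists2 tau, autk tau & tau z = z ^+ q.
Proof.
move=> cef hn; have [sI [sN [-> Ne uI If IP]]] := card_aut_factor hn.
have cN : coprime f (size sN) by rewrite coprime_sym; apply: coprime_dvdl cef.
rewrite Gauss_dvdl // => fI; have f0 := inertia_gt0.
have I0 : 0%N \in sI.
  apply/IP; split=> //; exists \1%VF; first exact: autk1.
  by rewrite id_lfunE expn0 expr1.
have sub : {subset sI <= iota 0 f} by move=> i /If; rewrite mem_iota.
have [|_ E1] := uniq_min_size uI sub.
  by rewrite size_iota; apply: dvdn_leq => //; case: (sI) I0.
(* The exponent is reduced because 1 is out of range when f = 1. *)
have : (1 %% f)%N \in sI by rewrite E1 mem_iota /= add0n ltn_mod.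
by move/IP => [_ [g ag]]; rewrite zeta_expq_mod expn1; exists g.
Qed.

Lemma frobenius_semidirect : (exists s, [/\ autk s, s z = z ^+ q & s ^+ f = 1]) ->
  aut_semidirect Lz f.
Proof.
move=> [s [as_ sz sf]]; have f0 := inertia_gt0.
pose t := s ^+ f.-1.
have st : s * t = 1 by rewrite /t -exprS prednK.
have ts : t * s = 1 by rewrite /t -exprSr prednK.
have tf : t ^+ f = 1 by rewrite /t -exprM mulnC exprM sf expr1n.
have cst : GRing.comm s t by rewrite /GRing.comm st ts.
have stX c : s ^+ c * t ^+ c = 1 by rewrite -exprMn_comm // st expr1n.
have tsX c : t ^+ c * s ^+ c = 1 by rewrite -exprMn_comm ?ts ?expr1n //; apply/commr_sym.
have at_ : autk t by apply: autk_exp.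
have aM g h : autk g -> autk h -> autk (g * h) by move=> ag ah; rewrite -lfun_compE autk_comp.
have sXz c : (s ^+ c) z = z ^+ (q ^ c) by apply: autk_exp_zeta.
pose N := autM Lz.
have Nconj g h n : autk g -> autk h -> g * h = 1 -> N n -> N (g * n * h).
  move=> ag ah gh /autMP[an nz]; apply/autMP; split; first by rewrite !aM.
  have [i fi gz] := autk_zeta ag.
  by rewrite !lfun_mulE gz autkX // nz -gz -lfun_mulE gh id_lfunE.
(* The product of ['End(E)] is composition in reverse order: the action is conjugation by s ^+ c,
   that is n |-> s^c o n o s^-c, and the pair (n, c) goes to n o s^c. *)
exists (fun c n => t ^+ c * n * s ^+ c), (fun n c => s ^+ c * n).
split; [|split].
- split.
  + by move=> c n _; apply: Nconj; rewrite ?autk_exp.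
  + move=> c n m _ _ _; rewrite !lfun_compE !mulrA; congr (_ * _ * _).
    by rewrite -[in RHS](mulrA _ (s ^+ c)) stX mulr1.
  + move=> c n m _ _ _ /(congr1 (fun u => s ^+ c * u * t ^+ c)).
    by rewrite !mulrA stX !mul1r -!mulrA stX !mulr1.
  + move=> c m fc Nm; exists (s ^+ c * m * t ^+ c).
      by apply: Nconj; rewrite ?autk_exp.
    by rewrite !mulrA tsX mul1r -mulrA tsX mulr1.
- split=> [n _|c1 c2 n _ _ _]; first by rewrite !expr0 mulr1 mul1r.
  have -> : s ^+ ((c1 + c2) %% f) = s ^+ c2 * s ^+ c1 by rewrite (expr_mod _ sf) addnC exprD.
  have -> : t ^+ ((c1 + c2) %% f) = t ^+ c1 * t ^+ c2 by rewrite (expr_mod _ tf) exprD.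
  by rewrite !mulrA.
- split.
  + by move=> n c /autMP[an _] _; rewrite aM ?autk_exp.
  + move=> n1 c1 n2 c2 /autMP[an1 nz1] fc1 /autMP[an2 nz2] fc2 E1.
    have c12 : c1 = c2.
      apply: zeta_conj_inj => //.
      have := congr1 (fun u : 'End(E) => u z) E1; rewrite !lfun_mulE !sXz !autkX //.
      by rewrite nz1 nz2.
    subst c2; split=> //; move: E1 => /(congr1 (fun u => t ^+ c1 * u)).
    by rewrite !mulrA tsX !mul1r.
  + move=> g ag; have [c fc gz] := autk_zeta ag.
    exists (t ^+ c * g), c; last by rewrite mulrA stX mul1r.
    split=> //; apply/autMP; split; first by rewrite aM ?autk_exp.
    (* The exponents of q add up to c + f.-1 * c = f * c, a multiple of f, so z is fixed. *)
    have := autk_exp_zeta (f.-1 * c) as_ sz; rewrite exprM -/t => tz.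
    rewrite lfun_mulE tz autkX // gz -exprM -expnD -mulSn prednK //.
    by rewrite -zeta_expq_mod modnMr expn0 expr1.
  + move=> n1 c1 n2 c2 _ _ _ _; rewrite !lfun_compE (expr_mod _ sf) addnC exprD.
    by rewrite -!mulrA; congr (_ * _); rewrite !mulrA stX mul1r.
Qed.

(** The subgroup is the image under [Psi] of the factor Z/f. *)
Lemma semidirect_subgroup : aut_semidirect Lz f -> aut_subgroup E f.
Proof.
have f0 := inertia_gt0.
case=> phi [Psi [[p1 p2 p3 p4] [[q1 q2] [r1 r2 r3 r4]]]].
have N1 : autM Lz \1%VF by apply/autMP; split; [apply: autk1 | rewrite id_lfunE].
(* Multiplicativity only says that [phi c] maps the identity to an idempotent; an idempotent
   automorphism is the identity. *)
have phi1 c : (c < f)%N -> phi c \1%VF = \1%VF.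
  move=> fc; apply: autk_idempotent; first by case/autMP: (p1 c _ fc N1).
  by rewrite -p2 // comp_lfun1l.
have PsiD c1 c2 : (c1 < f)%N -> (c2 < f)%N ->
    (Psi \1%VF c1 \o Psi \1%VF c2)%VF = Psi \1%VF ((c1 + c2) %% f)%N.
  by move=> h1 h2; rewrite -r4 // phi1 // comp_lfun1l.
have Psi0 : Psi \1%VF 0%N = \1%VF.
  by apply: autk_idempotent; [apply: r1 | rewrite PsiD // mod0n].
have inI c : (c < f)%N -> c \in iota 0 f by rewrite mem_iota.
exists [seq Psi \1%VF c | c <- iota 0 f]; split; split.
- rewrite map_inj_in_uniq ?iota_uniq // => c c'; rewrite !mem_iota /= !add0n => h h' E1.
  by have [] := r2 _ _ _ _ N1 h N1 h' E1.
- by rewrite size_map size_iota.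
- by move=> g /mapP[c]; rewrite mem_iota => h ->; apply: r1.
- by apply/mapP; exists 0%N; rewrite ?inI.
- move=> g h /mapP[c]; rewrite mem_iota => hc -> /mapP[d]; rewrite mem_iota => hd ->.
  by rewrite PsiD //; apply: map_f; rewrite inI // ltn_mod.
- move=> g /mapP[c]; rewrite mem_iota => hc ->.
  rewrite (autk_comp_eq1 (h := Psi \1%VF ((f - c) %% f)%N)).
  + by apply: map_f; rewrite inI // ltn_mod.
  + exact: r1.
  by rewrite PsiD ?ltn_mod // modnDmr subnKC ?modnn // ltnW.
Qed.

Lemma subgroup_subfield : aut_subgroup E f -> exists E' : {subfield E}, \dim E' = e.
Proof.
case=> s [[us ss as_] [s1 sM _]].
have [F hF] := exists_fixed_field as_.
exists F; have := artin_dim us as_ s1 sM hF; rewrite dim_ext ss mulnC => /eqP.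
by rewrite eqn_pmul2l ?inertia_gt0 // => /eqP.
Qed.

Lemma strong_extension_tfae (Eur : {subfield E}) : max_unram v Eur ->
  ((normal_ext E \/ tensor_decomp v E) -> strong_ext w q Eur) /\
  (coprime e f ->
     [<-> strong_ext w q Eur;
          exists2 n, card_aut E n & (f %| n)%N;
          aut_semidirect Eur f;
          aut_subgroup E f;
          exists E' : {subfield E}, \dim E' = e;
          tensor_decomp v E]).
Proof.
move=> /max_unramE ->.
have tensor_strong : tensor_decomp v E -> strong_ext w q Lz.
  move=> /tensor_decomp_subfield[E' dE' full]; apply/strong_extP.
  by have [tau [at_ _ tz]] := disjoint_frobenius dE' full; exists tau.
split=> [[/normal_frobenius/strong_extP//|//]|cef]; tfae.
- by move=> /strong_extP/frobenius_card_aut.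
- move=> [n hn fn]; apply/frobenius_semidirect/frobenius_split => //.
  exact: card_aut_frobenius hn fn.
- exact: semidirect_subgroup.
- exact: subgroup_subfield.
- by move=> [E' dE']; apply: subfield_tensor_decomp dE'.
- exact: tensor_strong.
Qed.

End LocalFieldExtension.

Theorem mainTheorem15
  (k : fieldType) (v : k -> int) (hk : local_field v)
  (q : nat) (hq : res_card v q)
  (E : fieldExtType k) (w : E -> int) (e : nat) (hw : ext_val v w e)
  (f : nat) (hf : res_card w (q ^ f))
  (Eur : {subfield E}) (hEur : max_unram v Eur) :
  ((normal_ext E \/ tensor_decomp v E) -> strong_ext w q Eur) /\
  (coprime e f ->
     [<-> strong_ext w q Eur;
          exists2 n, card_aut E n & (f %| n)%N;
          aut_semidirect Eur f;
          aut_subgroup E f;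
          exists E' : {subfield E}, \dim E' = e;
          tensor_decomp v E]).
Proof.
case: hk => dv kc _; case: hw => dw wa.
have vv := dval_val dv; have wv := dval_val dw.
have [[pi [pi0 vpi]] _ _] := dv; have [[pE [pE0 wpE]] _ _] := dw.
have [Kk [rk cKk]] := exists_residue_map vv hq.
have [KE [rE cKE]] := exists_residue_map wv hf.
have hwe : ext_pval v w e by [].
have [z zP] := exists_zeta vv kc pi0 vpi rk cKk hwe pE0 wpE rE cKE.
exact: (strong_extension_tfae vv kc pi0 vpi rk cKk hwe pE0 wpE rE cKE zP hEur).
Qed.
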